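(* Let $m\ge2$ and $0\le q\le m-1$ be integers, let $\mu:=(2^{(q)},1^{(2m-2q)},0^{(q)})$, and let $F\preceq F'\preceq A_{D_m}$ be subfacets of the base alcove. Then $$\mathrm{Adm}_{F',F,D_m}(\mu)=\mathrm{Adm}^{\mathrm{vert}}_{F',F,D_m}(\mu),$$ i.e. an element of $W_{F',D_m}\backslash\widetilde W_{D_m}/W_{F,D_m}$ is $\mu$-admissible if and only if it is $\mu$-vertexwise admissible.
   Context: Notation. $(d^{(i)},e^{(j)},\dots)$ denotes the vector with $d$ repeated $i$ times, then $e$ repeated $j$ times, etc. $i^*:=2m+1-i$ for $i\in\{1,\dots,2m\}$. Root datum of split $GO_{2m}$. $X_*:=\{x\in\mathbb Z^{2m}: x_1+x_{2m}=\dots=x_m+x_{m+1}\}$; $Q^\vee:=\{x\in X_*: x_i+x_{i^*}=0\ \forall i,\ x_1+\dots+x_m\text{ even}\}$; $S_{2m}^\circ$ is the group of even permutations $\sigma\in S_{2m}$ with $\sigma(i^* )=\sigma(i)^*$ for all $i$. $\widetilde W_{D_m}:=X_*\rtimes S_{2m}^\circ$ acts on $\mathcal A:=X_*\otimes\mathbb R\subset\mathbb R^{2m}$ by affine transformations, $X_*$ by translations ($t_\lambda$) and $S_{2m}^\circ$ by permuting coordinates; $W_{\mathrm{aff},D_m}:=Q^\vee\rtimes S_{2m}^\circ$. The affine root hyperplanes are $\{x_i-x_j=d\}$, $j\ne i,i^*$, $d\in\mathbb Z$; they determine facets and alcoves in $\mathcal A$ (minimal facets are lines parallel to $(1,\dots,1)$).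 The base alcove is $A_{D_m}:=\{x\in\mathcal A: x_1,\,x_{2m}-1<x_2<\dots<x_{m-1}<x_m,\,x_{m+1}\}$ (for $m=2$: $x_1,x_4-1<x_2,x_3$). For facets, $\mathbf f\preceq\mathbf f'$ means $\mathbf f\subset\overline{\mathbf f'}$. For a facet $F$, $W_{F,D_m}$ is the stabilizer (equivalently pointwise fixer) of $F$ in $W_{\mathrm{aff},D_m}$. Bruhat order. $W_{\mathrm{aff},D_m}$ is a Coxeter group generated by the reflections across the walls of $A_{D_m}$; with $\Omega$ the stabilizer of $A_{D_m}$ in $\widetilde W_{D_m}$, $\widetilde W_{D_m}=W_{\mathrm{aff},D_m}\rtimes\Omega$, $\ell(x\tau)=\ell(x)$ and $x\tau\le x'\tau'$ iff $\tau=\tau'$ and $x\le x'$. For subfacets $F_1,F_2\preceq A_{D_m}$ each double coset in $W_{F_1,D_m}\backslash\widetilde W_{D_m}/W_{F_2,D_m}$ contains a unique element of minimal length, and the Bruhat order on double cosets is defined by comparing these. Admissibility. $\mathrm{Adm}_{F_1,F_2,D_m}(\mu)$ is the set of $w\in W_{F_1,D_m}\backslash\widetilde W_{D_m}/W_{F_2,D_m}$ with $w\le W_{F_1,D_m}t_\lambda W_{F_2,D_m}$ for some $\lambda\in S_{2m}^\circ\mu$. For $F\preceq F'\preceq A_{D_m}$ and a minimal subfacet $\mathbf v\preceq F$, let $\rho_{\mathbf v}:W_{F',D_m}\backslash\widetilde W_{D_m}/W_{F,D_m}\to W_{\mathbf v,D_m}\backslash\widetilde W_{D_m}/W_{\mathbf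 v,D_m}$ be the natural map. Then $\mathrm{Adm}^{\mathrm{vert}}_{F',F,D_m}(\mu):=\bigcap_{\mathbf v}\rho_{\mathbf v}^{-1}(\mathrm{Adm}_{\mathbf v,\mathbf v,D_m}(\mu))$, the intersection over all minimal subfacets $\mathbf v$ of $F$. *)

(* Defs.v *)
From HB Require Import structures.
From Stdlib Require Import Relation_Operators.
From mathcomp Require Import all_boot all_order all_algebra all_fingroup.
From mathcomp Require Import all_classical all_reals topology normedtype.

Set Implicit Arguments.
Unset Strict Implicit.
Unset Printing Implicit Defensive.

Import Order.TTheory GRing.Theory Num.Theory.
Import numFieldNormedType.Exports.

Local Open Scope classical_set_scope.
Local Open Scope ring_scope.

(* Coordinates are 0-indexed: x_1, ..., x_2m are the entries of x : 'rV_(2 * m)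
   at the ordinals 0, ..., 2m - 1, and i^* = 2m + 1 - i becomes rev_ord i. *)

Section CoxeterGroup.
Variables (G : groupType) (W S : set G).

Definition is_word (w : G) (k : nat) : Prop :=
  exists s : seq G,
    [/\ size s = k, (forall x, x \in s -> S x) & w = (\prod_(x <- s) x)%g].

Definition cox_length (w : G) : nat :=
  xget 0%N [set k | is_word w k /\ forall l, is_word w l -> (k <= l)%N].

Definition cox_reflection : set G :=
  [set t | exists w s, [/\ W w, S s & t = (w * s * w^-1)%g]].

Definition bruhat_step (x y : G) : Prop :=
  exists t, [/\ cox_reflection t, y = (x * t)%g
              & (cox_length x < cox_length y)%N].

Definition cox_bruhat : G -> G -> Prop := clos_refl_trans G bruhat_step.

End CoxeterGroup.

(* The semidirect product Z^n ><| S_n. MathComp's product on 'S_n applies the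
   left factor first, so that s . x := (x_(s i))_i = col_perm s x is a left
   action. *)
Record affperm (n : nat) := AffPerm { transl : 'rV[int]_n; lin : 'S_n }.

Section AffPermGroup.
Variable n : nat.
Implicit Types u v w : affperm n.

Definition affperm_pair u := (transl u, lin u).
Definition pair_affperm (p : 'rV[int]_n * 'S_n) := AffPerm p.1 p.2.

Lemma affperm_pairK : cancel affperm_pair pair_affperm.
Proof. by case. Qed.

HB.instance Definition _ := Choice.copy (affperm n) (can_type affperm_pairK).

Definition affperm_one : affperm n := AffPerm 0 1%g.

Definition affperm_mul u v : affperm n :=
  AffPerm (transl u + col_perm (lin u) (transl v)) (lin u * lin v)%g.

Definition affperm_inv u : affperm n :=
  AffPerm (- col_perm (lin u)^-1%g (transl u)) (lin u)^-1%g.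

Lemma col_permD (s : 'S_n) (x y : 'rV[int]_n) :
  col_perm s (x + y) = col_perm s x + col_perm s y.
Proof. by apply/rowP => i; rewrite !mxE. Qed.

Lemma affperm_mulA : associative affperm_mul.
Proof.
move=> [a s] [b t] [c u]; rewrite /affperm_mul /=.
by rewrite col_permD col_permM addrA mulgA.
Qed.

Lemma affperm_mul1 : left_id affperm_one affperm_mul.
Proof. by move=> [a s]; rewrite /affperm_mul /= col_perm1 add0r mul1g. Qed.

Lemma affperm_mulr1 : right_id affperm_one affperm_mul.
Proof.
move=> [a s]; rewrite /affperm_mul /= mulg1; congr AffPerm.
by apply/rowP => i; rewrite !mxE addr0.
Qed.

Lemma affperm_mulV : left_inverse affperm_one affperm_inv affperm_mul.
Proof. by move=> [a s]; rewrite /affperm_mul /affperm_inv /= addNr mulVg. Qed.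

Lemma affperm_mulrV : right_inverse affperm_one affperm_inv affperm_mul.
Proof.
move=> [a s]; rewrite /affperm_mul /affperm_inv /= mulgV; congr AffPerm.
by apply/rowP => i; rewrite !mxE -permM mulgV perm1 subrr.
Qed.

HB.instance Definition _ := isGroup.Build (affperm n)
  affperm_mulA affperm_mul1 affperm_mulr1 affperm_mulV affperm_mulrV.

End AffPermGroup.

Definition translation (n : nat) (l : 'rV[int]_n) : affperm n := AffPerm l 1%g.

Section RootDatum.
Variable m : nat.

Definition cochar : set 'rV[int]_(2 * m) :=
  [set x | forall i j, x 0 i + x 0 (rev_ord i) = x 0 j + x 0 (rev_ord j)].

Definition coroot_lattice : set 'rV[int]_(2 * m) :=
  [set x | [/\ cochar x,
               (forall i, x 0 i + x 0 (rev_ord i) = 0)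
             & (2 %| \sum_(i < 2 * m | (i < m)%N) x 0 i)%Z]].

Definition fin_weyl : set 'S_(2 * m) :=
  [set s | ~~ odd_perm s /\ forall i, s (rev_ord i) = rev_ord (s i)].

Definition ext_weyl : set (affperm (2 * m)) :=
  [set w | cochar (transl w) /\ fin_weyl (lin w)].

Definition aff_weyl : set (affperm (2 * m)) :=
  [set w | coroot_lattice (transl w) /\ fin_weyl (lin w)].

Definition weyl_orbit (mu : 'rV[int]_(2 * m)) : set 'rV[int]_(2 * m) :=
  [set l | exists2 s, fin_weyl s & l = col_perm s mu].

(* (2^(q), 1^(2m - 2q), 0^(q)) *)
Definition mu_ (q : nat) : 'rV[int]_(2 * m) :=
  \row_(i < 2 * m)
    (if (i < q)%N then 2 else if (i < 2 * m - q)%N then 1 else 0).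

End RootDatum.

Section Apartment.
Variables (R : realType) (m : nat).
Local Notation V := 'rV[R]_(2 * m).
Implicit Types (x y : V) (w : affperm (2 * m)) (i j : 'I_(2 * m)) (d : int).

(* The real span of cochar in R^(2m). *)
Definition apartment : set V :=
  [set x | forall i j, x 0 i + x 0 (rev_ord i) = x 0 j + x 0 (rev_ord j)].

Definition aff_act w x : V := map_mx intr (transl w) + col_perm (lin w) x.

Definition root_index i j : Prop := j <> i /\ j <> rev_ord i.

Definition root_hyperplane i j d : set V :=
  [set x | apartment x /\ x 0 i - x 0 j = d%:~R].

Definition is_root_hyperplane (H : set V) : Prop :=
  exists i j d, root_index i j /\ H = root_hyperplane i j d.

Definition same_facet x y : Prop :=
  forall i j d, root_index i j ->
    Num.sg (x 0 i - x 0 j - d%:~R) = Num.sg (y 0 i - y 0 j - d%:~R).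

Definition is_facet (f : set V) : Prop :=
  exists2 x, apartment x & f = [set y | apartment y /\ same_facet x y].

(* f is a subfacet of g; the closure in R^(2m) is also the closure in the
   apartment, which is a closed subspace. *)
Definition facet_le (f g : set V) : Prop := f `<=` closure g.

Definition is_minimal_facet (v : set V) : Prop :=
  is_facet v /\ forall f, is_facet f -> facet_le f v -> f = v.

(* In 1-indexed coordinates: x_1 < x_l and x_2m - 1 < x_l for 2 <= l <= m + 1,
   and x_k < x_l for 2 <= k <= m - 1, k < l <= m + 1. For m >= 3 these follow
   from the chain x_1, x_2m - 1 < x_2 < ... < x_(m-1) < x_m, x_(m+1) by
   transitivity; for m = 2 they say x_1, x_4 - 1 < x_2, x_3. *)
Definition base_alcove : set V :=
  [set x | [/\ apartment x,
     (forall k l : 'I_(2 * m), (k < l <= m)%N -> (k.+1 < m)%N ->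
        x 0 k < x 0 l)
   & (forall k l : 'I_(2 * m), k = 0%N :> nat -> (0 < l <= m)%N ->
        x 0 (rev_ord k) - 1 < x 0 l)]].

Definition facet_support (f : set V) : set V :=
  [set x | apartment x /\
     forall H, is_root_hyperplane H -> f `<=` H -> H x].

Definition is_wall (H : set V) : Prop :=
  is_root_hyperplane H /\
  exists f, [/\ is_facet f, facet_le f base_alcove & facet_support f = H].

(* The coroot of the root x |-> x_i - x_j of GO_2m. *)
Definition coroot i j : V :=
  delta_mx 0 i - delta_mx 0 j - delta_mx 0 (rev_ord i)
    + delta_mx 0 (rev_ord j).

Definition hyperplane_reflection i j d x : V :=
  x - (x 0 i - x 0 j - d%:~R) *: coroot i j.

Definition simple_reflection : set (affperm (2 * m)) :=
  [set s | aff_weyl s /\ exists i j d,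
     [/\ root_index i j, is_wall (root_hyperplane i j d)
       & forall x, apartment x -> aff_act s x = hyperplane_reflection i j d x]].

Definition Omega : set (affperm (2 * m)) :=
  [set w | ext_weyl w /\ aff_act w @` base_alcove = base_alcove].

Definition ext_length w : nat :=
  xget 0%N [set k | exists x t : affperm (2 * m),
                  [/\ aff_weyl x, Omega t, w = (x * t)%g
                    & k = cox_length simple_reflection x]].

Definition ext_bruhat w w' : Prop :=
  exists x x' t : affperm (2 * m),
    [/\ aff_weyl x, aff_weyl x', Omega t, w = (x * t)%g /\ w' = (x' * t)%g
      & cox_bruhat (@aff_weyl m) simple_reflection x x'].

Definition facet_stab (f : set V) : set (affperm (2 * m)) :=
  [set w | aff_weyl w /\ aff_act w @` f = f].

Implicit Types (F : set V) (D : set (affperm (2 * m))).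

(* W_F1 . D . W_F2, for a subset D of the extended affine Weyl group *)
Definition dcoset_span F1 D F2 : set (affperm (2 * m)) :=
  [set w | exists a x b : affperm (2 * m),
             [/\ facet_stab F1 a, D x, facet_stab F2 b
               & w = (a * x * b)%g]].

Definition double_coset F1 w F2 : set (affperm (2 * m)) :=
  dcoset_span F1 [set w] F2.

Definition double_cosets F1 F2 : set (set (affperm (2 * m))) :=
  [set D | exists2 w, ext_weyl w & D = double_coset F1 w F2].

Definition is_min_length D w : Prop :=
  D w /\ forall w', D w' -> (ext_length w <= ext_length w')%N.

Definition dcoset_bruhat D D' : Prop :=
  exists w w', [/\ is_min_length D w, is_min_length D' w' & ext_bruhat w w'].

Definition Adm F1 F2 (mu : 'rV[int]_(2 * m)) : set (set (affperm (2 * m))) :=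
  [set D | double_cosets F1 F2 D /\
     exists2 l, weyl_orbit mu l
       & dcoset_bruhat D (double_coset F1 (translation l) F2)].

(* For F <= F' and a minimal subfacet v of F, the stabilizers of F' and F are
   contained in that of v, so that D |-> W_v . D . W_v is the natural map rho_v
   on double cosets. *)
Definition Adm_vert F1 F (mu : 'rV[int]_(2 * m)) :
    set (set (affperm (2 * m))) :=
  [set D | double_cosets F1 F D /\
     forall v, is_minimal_facet v -> facet_le v F ->
       Adm v v mu (dcoset_span v D v)].

End Apartment.

(* Main.v *)
(* The argument works with points of the apartment instead of words. For a base
   point b let <=_b be the order generated by the steps z -> s_H z, where H does
   not separate b from z; for b in the base alcove this is the Bruhat order.
   Moving b across one wall changes <=_b in a controlled way. Three consequences:
   - if q <=_p t_l p for some l in the orbit of mu, with p in the base alcove,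
     then for every b there is l' in the orbit with q <=_b t_l' p;
   - Deodhar's criterion: x f <=_b y f as soon as x v <=_b y v for all vertices v
     of the facet of f;
   - x p <=_b y p implies x p <=_p y p if x p is on the side of p for every
     hyperplane separating b from p.
   Given x, choose b far away from p, opposite to the direction from p to x f.
   From that b all t_l p lie below a single t_l0 p. Vertexwise admissibility of x
   then gives x v <=_b t_l0 v for all vertices v of f (a left factor u in the
   fixer of v is absorbed by moving b to u b), hence x f <=_b t_l0 f, hence
   x <= t_l0 u with u in the fixer of f. This is the method of obtuse cones of
   Haines and He. *)

Require Import Defs.
From Stdlib Require Import Relation_Operators.
From mathcomp Require Import all_boot all_order all_algebra all_fingroup.
From mathcomp Require Import all_classical all_reals topology normedtype.
From mathcomp Require Import ring lra zify.

Set Implicit Arguments.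
Unset Strict Implicit.
Unset Printing Implicit Defensive.

Import Order.TTheory GRing.Theory Num.Theory.
Import numFieldNormedType.Exports.

Local Open Scope classical_set_scope.
Local Open Scope ring_scope.

(** * Affine roots and the extended affine Weyl group acting on points *)

Section Hyperplanes.
Variables (R : realType) (m : nat).
Local Notation V := 'rV[R]_(2 * m).
Local Notation apt := (@apartment R m).
Implicit Types (x y z b h : V) (i j k : 'I_(2 * m)).

(** Comparing points lets one relation serve alcoves and facets alike: a hyperplane through a point
    gives a trivial step there, so chains descend from a regular point to the closure of its alcove,
    and strict steps at a facet point lift back. What a facet point forgets is the coset of the
    affine Weyl group, since an extended element may fix it without lying in that group; the coset
    is therefore carried along separately. The choice of b serves both ends of the argument. It is
    antidominant for the direction from p to x f, so that seen from b the dominant translate is the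
    largest; and every hyperplane separating b from the base alcove has x f on the side of the
    alcove, so that the final inequality can be brought back. The point p is generic to make this
    direction regular. The required distance comes from the number 2, the largest difference of two
    coordinates in the orbit of mu: beyond it, b lies on the low side of both hyperplanes whose
    reflections replace a translate by a more dominant one. Uniqueness of the dominant translate
    rests on q < m, through a coordinate equal to 1. *)

Definition affroot := ('I_(2 * m) * 'I_(2 * m) * int)%type.
Implicit Types (H K : affroot) (w : affperm (2 * m)).

Definition valid H := root_index H.1.1 H.1.2.
Definition aval H x : R := x 0 H.1.1 - x 0 H.1.2 - H.2%:~R.
Definition refl H x : V := hyperplane_reflection H.1.1 H.1.2 H.2 x.
Definition affroot_opp H : affroot := (H.1.2, H.1.1, - H.2).
Definition affroot_pull w H : affroot :=
  (lin w H.1.1, lin w H.1.2,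
   H.2 - transl w 0 H.1.1 + transl w 0 H.1.2).

Lemma rev_ord_neq i : rev_ord i != i.
Proof. by apply/eqP => /(congr1 val) /=; have := ltn_ord i; lia. Qed.

Lemma eq_rev_ord i j : (rev_ord i == j) = (i == rev_ord j).
Proof. by apply/eqP/eqP => [<-|->]; rewrite rev_ordK. Qed.

Lemma affroot_opp_valid H : valid H -> valid (affroot_opp H).
Proof.
case=> h1 h2; split=> /= [e|e]; first by apply: h1.
by apply: h2; rewrite e rev_ordK.
Qed.

Lemma aval_opp H x : aval (affroot_opp H) x = - aval H x.
Proof. by rewrite /aval /= rmorphN /=; ring. Qed.

Lemma aval_segment H x y t : aval H (x + t *: (y - x)) = aval H x + t * (aval H y -
  aval H x).
Proof. by rewrite /aval !mxE; ring. Qed.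

Lemma aval_pull w H x : aval H (aff_act w x) = aval (affroot_pull w H) x.
Proof. by rewrite /aval /affroot_pull /= !mxE !rmorphD /= rmorphN /=; ring. Qed.

Lemma corootE i j k : @coroot R m i j 0 k =
  (k == i)%:R - (k == j)%:R - (k == rev_ord i)%:R + (k == rev_ord j)%:R.
Proof. by rewrite !mxE !eqxx. Qed.

Lemma apt_coroot i j : apt (coroot R i j).
Proof.
have e k : coroot R i j 0 k + coroot R i j 0 (rev_ord k) = 0.
  by rewrite !corootE !eq_rev_ord !rev_ordK; ring.
by move=> k l; rewrite !e.
Qed.

Lemma aptD x y : apt x -> apt y -> apt (x + y).
Proof.
by move=> hx hy i j; rewrite !mxE addrACA (hx i j) (hy i j) addrACA.
Qed.

Lemma aptZ t x : apt x -> apt (t *: x).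
Proof. by move=> hx i j; rewrite !mxE -!mulrDr (hx i j). Qed.

Lemma aptN x : apt x -> apt (- x).
Proof. by rewrite -scaleN1r; exact: aptZ. Qed.

Lemma aptB x y : apt x -> apt y -> apt (x - y).
Proof. by move=> hx /aptN; exact: aptD. Qed.

Lemma apt_segment x y t : apt x -> apt y -> apt (x + t *: (y - x)).
Proof. by move=> hx hy; apply/aptD/aptZ/aptB. Qed.

Lemma apt_refl H x : apt x -> apt (refl H x).
Proof. by move=> hx; apply/aptB/aptZ => //; exact: apt_coroot. Qed.

Lemma reflE H x : refl H x = x - aval H x *: coroot R H.1.1 H.1.2.
Proof. by []. Qed.

Lemma coroot_root i j : root_index i j ->
  coroot R i j 0 i - coroot R i j 0 j = 2.
Proof.
case=> /eqP/negbTE h1 /eqP/negbTE h2; rewrite !corootE !eqxx.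
have h3 : (i == rev_ord j) = false by rewrite -eq_rev_ord eq_sym.
have h4 k : (k == rev_ord k) = false.
  by rewrite eq_sym; exact/negbTE/rev_ord_neq.
by rewrite !h4 [i == j]eq_sym h1 h2 h3 !subr0 !addr0 sub0r opprK.
Qed.

Lemma aval_refl H x : valid H -> aval H (refl H x) = - aval H x.
Proof.
move=> /coroot_root e; rewrite reflE.
have -> : aval H (x - aval H x *: coroot R H.1.1 H.1.2) =
  aval H x - aval H x * (coroot R H.1.1 H.1.2 0 H.1.1 - coroot R H.1.1 H.1.2 0 H.1.2).
  by move: (coroot _ _ _) => c; rewrite /aval !mxE; ring.
by rewrite e; ring.
Qed.

Lemma reflK H x : valid H -> refl H (refl H x) = x.
Proof.
by move=> hH; rewrite [LHS]reflE aval_refl // reflE scaleNr opprK subrK.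
Qed.

Lemma refl_fix H x : aval H x = 0 -> refl H x = x.
Proof. by move=> e; rewrite reflE e scale0r subr0. Qed.

Lemma affroot_pull_valid w H : (forall i, lin w (rev_ord i) = rev_ord (lin w i)) ->
  valid H -> valid (affroot_pull w H).
Proof.
move=> hw [h1 h2]; split=> /= [/perm_inj //|]; rewrite -hw => /perm_inj //.
Qed.

Lemma refl_pull w H x : (forall i, lin w (rev_ord i) = rev_ord (lin w i)) ->
  refl H (aff_act w x) = aff_act w (refl (affroot_pull w H) x).
Proof.
move=> hw; rewrite !reflE aval_pull.
apply/rowP => k; rewrite !mxE !eqxx /= !(inj_eq perm_inj) -!hw !(inj_eq perm_inj).
ring.
Qed.

End Hyperplanes.

(** * The order based at a point, and change of base *)

Section Signs.
Variable R : realType.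
Implicit Types a b c : R.

Lemma mul_gt0_trans a b c : 0 < a * b -> 0 < a * c -> 0 < b * c.
Proof.
move=> h1 h2; have := mulr_gt0 h1 h2.
rewrite mulrACA pmulr_rgt0 // -expr2 exprn_even_gt0 //=.
by apply: contraTneq h1 => ->; rewrite mul0r ltxx.
Qed.

Lemma mul_gt0_lt0 a b c : 0 < a * b -> a * c < 0 -> b * c < 0.
Proof.
by move=> h1 h2; rewrite -oppr_gt0 -mulrN (mul_gt0_trans h1) // mulrN oppr_gt0.
Qed.

End Signs.

Section Order.
Variables (R : realType) (m : nat).
Local Notation V := 'rV[R]_(2 * m).
Local Notation apt := (@apartment R m).
Local Notation affroot := (affroot m).
Implicit Types (x y z b h : V) (i j k : 'I_(2 * m)).
Implicit Types (H K : affroot) (w : affperm (2 * m)).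

(* Four affine roots vanish on each hyperplane, hence the comparison of zero sets. *)
Definition same_hyp K H := forall x, apt x -> aval K x = 0 <-> aval H x = 0.

Lemma aval_add_line H y x h t : aval H (y + t *: (x - h)) = aval H y + t * (aval H x -
  aval H h).
Proof. by rewrite /aval !mxE; ring. Qed.

Lemma aval_coroot H t : valid H ->
  aval H (t *: coroot R H.1.1 H.1.2) = 2 * t - H.2%:~R.
Proof.
move=> /(@coroot_root R) => <-; move: (coroot _ _ _) => c.
by rewrite /aval !mxE; ring.
Qed.

(** Otherwise [K] would vanish on [H] and at a point off [H], hence on the whole apartment; but it
    takes the value 1 at [y]. *)
Lemma incl_same_hyp H K : valid H -> valid K ->
  (forall x, apt x -> aval H x = 0 -> aval K x = 0) -> same_hyp K H.
Proof.
move=> rH rK HK x ax; split; last exact: HK.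
move=> Kx; apply/eqP/negP => /negP Hx.
pose h := (H.2%:~R / 2) *: coroot R H.1.1 H.1.2.
have ah : apt h by apply/aptZ/apt_coroot.
have Hh : aval H h = 0 by rewrite aval_coroot //; field.
pose y := ((K.2%:~R + 1) / 2) *: coroot R K.1.1 K.1.2.
have ay : apt y by apply/aptZ/apt_coroot.
have Ky : aval K y = 1 by rewrite aval_coroot //; field.
have := HK (y + (- aval H y / aval H x) *: (x - h)).
rewrite !aval_add_line Hh Kx Ky (HK h) // subr0 divfK // subrr subr0 mulr0 addr0.
move=> /(_ _ erefl)/eqP; rewrite oner_eq0 => e.
by have : false by apply/e/aptD => //; apply/aptZ/aptB.
Qed.

Lemma sum_delta i (f : 'I_(2 * m) -> R) : \sum_k (k == i)%:R * f k = f i.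
Proof.
rewrite (bigD1 i) //= eqxx mul1r big1 ?addr0 // => k /negbTE ->.
by rewrite mul0r.
Qed.

(** On the apartment all dual pairs have the same sum, so the two halves of the coroot contribute
    equally. Hence the coroot is normal to its hyperplanes. *)
Lemma coroot_dot i j x : apt x ->
  \sum_k coroot R i j 0 k * x 0 k = 2 * (x 0 i - x 0 j).
Proof.
move=> ax; under eq_bigr do rewrite corootE !mulrDl !mulNr.
rewrite !big_split /= !sumrN !sum_delta.
by have := ax i j; lra.
Qed.

(** The midpoints between [z] and its two mirror images lie on the common hyperplane. Their
    difference [d] is a combination of the two coroots, both orthogonal to [d], so its norm is 0. *)
Lemma same_hyp_reflection K H z : same_hyp K H -> valid H -> valid K -> apt z ->
  refl K z = refl H z.
Proof.
move=> e rH rK az.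
pose mid H := z + 2^-1 *: (refl H z - z).
have am H1 : apt (mid H1) by apply: apt_segment => //; exact: apt_refl.
have h0 H1 : valid H1 -> aval H1 (mid H1) = 0.
  by move=> r; rewrite aval_segment aval_refl //; field.
have hHK : aval H (mid K) = 0 := (e _ (am K)).1 (h0 K rK).
have hKH : aval K (mid H) = 0 := (e _ (am H)).2 (h0 H rH).
pose d := mid H - mid K.
have ad : apt d by apply: aptB.
have dE : d = (aval K z / 2) *: coroot R K.1.1 K.1.2
              - (aval H z / 2) *: coroot R H.1.1 H.1.2.
  rewrite /d /mid !reflE; apply/rowP => k.
  by move: (coroot _ _ _) (coroot _ _ _) => a c; rewrite !mxE; field.
have dEk k : d 0 k = aval K z / 2 * coroot R K.1.1 K.1.2 0 k
                     - aval H z / 2 * coroot R H.1.1 H.1.2 0 k.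
  by rewrite dE; move: (coroot _ _ _) (coroot _ _ _) => a c; rewrite !mxE.
have dd H1 : aval H1 (mid H) = 0 -> aval H1 (mid K) = 0 ->
    d 0 H1.1.1 - d 0 H1.1.2 = 0.
  by rewrite /d; move: (mid H) (mid K) => a c; rewrite /aval !mxE => h1 h2; lra.
have d0 : \sum_k d 0 k ^+ 2 = 0.
  under eq_bigr => k _ do rewrite expr2 {1}dEk mulrBl -!mulrA.
  rewrite big_split /= sumrN -!mulr_sumr !coroot_dot //.
  by rewrite (dd H (h0 H rH) hHK) (dd K hKH (h0 K rK)) !mulr0 subrr.
have dk k : d 0 k = 0.
  apply/eqP; rewrite -sqrf_eq0; apply/eqP.
  by apply: (psumr_eq0P _ d0) => // l _; rewrite sqr_ge0.
rewrite !reflE; apply/rowP => k; have := dk k; rewrite dEk.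
by move: (coroot _ _ _) (coroot _ _ _) => a c; rewrite !mxE; lra.
Qed.

Inductive based_le b x : V -> Prop :=
| based_le_refl : based_le b x x
| based_le_step y H : based_le b x y -> valid H -> 0 < aval H b * aval H y -> based_le
  b x (refl H y).

Lemma based_le1 b x H : valid H -> 0 < aval H b * aval H x -> based_le b x (refl H x).
Proof. by move=> ? ?; apply: based_le_step => //; exact: based_le_refl. Qed.

Lemma based_le_trans b y x z : based_le b x y -> based_le b y z -> based_le b x z.
Proof. by move=> h; elim=> // t H _ h1 rH; exact: based_le_step. Qed.

Lemma based_le_ap b x y : based_le b x y -> apt x -> apt y.
Proof. by move=> h ax; elim: h => // t H _ h1 _ _; exact: apt_refl. Qed.

Lemma based_le1W b x H : valid H -> 0 <= aval H b * aval H x -> aval H b != 0 ->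
  based_le b x (refl H x).
Proof.
move=> rH; rewrite le_eqVlt => /orP[/eqP/esym/eqP|h _]; last exact: based_le1.
rewrite mulf_eq0 => /orP[-> //|/eqP h _]; rewrite refl_fix //; exact: based_le_refl.
Qed.

Definition reflp i j : 'S_(2 * m) := (tperm i j * tperm (rev_ord i) (rev_ord j))%g.

Definition corootz i j : 'rV[int]_(2 * m) :=
  \row_k ((k == i)%:R - (k == j)%:R - (k == rev_ord i)%:R + (k == rev_ord j)%:R).

(** The reflection in [H] as a group element; [rhoE] gives its action. In the parts on Weyl orbits a
    bound [rho] is a direction vector instead. *)
Definition rho H : affperm (2 * m) :=
  AffPerm (H.2 *: corootz H.1.1 H.1.2) (reflp H.1.1 H.1.2).

Lemma corootzE i j k : (corootz i j 0 k)%:~R = coroot R i j 0 k.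
Proof. by rewrite corootE mxE !rmorphD !rmorphN /= !mulrz_nat. Qed.

Lemma root_index_neq i j : root_index i j ->
  [/\ i == j = false, j == i = false, i == rev_ord j = false,
      j == rev_ord i = false & forall k, (k == rev_ord k) = false
        /\ (rev_ord k == k) = false].
Proof.
case=> /eqP/negbTE h1 /eqP/negbTE h2; split; rewrite // 1?eq_sym ?eq_rev_ord //.
move=> k; have /negbTE h := rev_ord_neq k; split=> //; by rewrite eq_sym.
Qed.

Lemma reflpP i j k : root_index i j -> 
  reflp i j k = if k == i then j else if k == j then i else
    if k == rev_ord i then rev_ord j else if k == rev_ord j then rev_ord i else k.
Proof.
move=> /root_index_neq[h1 h2 h3 h4 h5]; rewrite /reflp permM.
have h3' : (rev_ord i == j) = false by rewrite eq_rev_ord.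
have h4' : (rev_ord j == i) = false by rewrite eq_rev_ord.
case: (tpermP i j k) => [->|->|/eqP/negbTE -> /eqP/negbTE ->].
- by rewrite eqxx tpermD // ?(h5 j).2 // h3'.
- by rewrite h2 eqxx tpermD // ?(h5 i).2 // h4'.
case: tpermP => [->|->|/eqP/negbTE -> /eqP/negbTE -> //].
- by rewrite eqxx.
by rewrite (inj_eq rev_ord_inj) h2 eqxx.
Qed.

Lemma reflp_rev i j k : root_index i j ->
  reflp i j (rev_ord k) = rev_ord (reflp i j k).
Proof.
move=> rij; rewrite !reflpP //; have [h1 h2 h3 h4 h5] := root_index_neq rij.
rewrite !(inj_eq rev_ord_inj) !eq_rev_ord.
have [->|ki] := eqVneq k i; first by rewrite h3 (h5 i).1.
have [->|kj] := eqVneq k j; first by rewrite h4 (h5 j).1.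
have [_|_] := eqVneq k (rev_ord i); first by rewrite rev_ordK.
by have [_|_] := eqVneq k (rev_ord j); rewrite ?rev_ordK.
Qed.

Lemma fin_weyl_reflp i j : root_index i j -> fin_weyl (reflp i j).
Proof.
move=> rij; split; last by move=> k; exact: reflp_rev.
have [h1 _ _ _ _] := root_index_neq rij.
by rewrite odd_permM !odd_tperm (inj_eq rev_ord_inj) h1.
Qed.

Lemma aff_actE w x k : aff_act w x 0 k = (transl w 0 k)%:~R + x 0 (lin w k).
Proof. by rewrite !mxE. Qed.

Lemma rhoE H x : valid H -> apt x -> aff_act (rho H) x = refl H x.
Proof.
move=> rH ax; apply/rowP => k.
have -> : refl H x 0 k = x 0 k - aval H x * coroot R H.1.1 H.1.2 0 k.
  by rewrite reflE; move: (coroot _ _ _) => c; rewrite !mxE.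
rewrite aff_actE.
have -> : (transl (rho H) 0 k)%:~R = H.2%:~R * coroot R H.1.1 H.1.2 0 k.
  by rewrite -corootzE -rmorphM /=; move: (corootz _ _) => c; rewrite !mxE.
rewrite corootE /= reflpP //.
have := ax H.1.1 H.1.2; move: (root_index_neq rH); case: H {rH} => [[i j] d] /=.
move=> [h1 h2 h3 h4 h5] e; rewrite /aval /=.
have [->|_] := eqVneq k i; first by rewrite h1 h3 (h5 i).1 /=; lra.
have [->|_] := eqVneq k j; first by rewrite h4 (h5 j).1 /=; lra.
have [->|_] := eqVneq k (rev_ord i); first by rewrite (inj_eq rev_ord_inj) h1 /=; lra.
by have [->|_] := eqVneq k (rev_ord j); rewrite /=; lra.
Qed.

Lemma aval_pull_rho H0 H x : valid H0 -> apt x ->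
  aval (affroot_pull (rho H0) H) x = aval H (refl H0 x).
Proof. by move=> r ax; rewrite -aval_pull rhoE. Qed.

Lemma valid_pull_rho H0 H : valid H0 -> valid H -> valid (affroot_pull (rho H0) H).
Proof. by move=> r; apply: affroot_pull_valid => k; exact: reflp_rev. Qed.

Lemma refl_pull_rho H0 H x : valid H0 -> valid H -> apt x ->
  refl (affroot_pull (rho H0) H) x = refl H0 (refl H (refl H0 x)).
Proof.
move=> r0 r ax; rewrite -[X in refl H X]rhoE // refl_pull; last first.
  by move=> k; exact: reflp_rev.
by rewrite rhoE ?reflK //; apply: apt_refl.
Qed.

Lemma same_hyp_pull_rho H0 K : valid H0 -> valid K -> same_hyp (affroot_pull (rho H0)
  K) H0 -> same_hyp K H0.
Proof.
move=> r0 rK e; apply: incl_same_hyp => // x ax hx.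
have := (e _ (apt_refl H0 ax)).2; rewrite aval_pull_rho ?reflK //; last exact: apt_refl.
by apply; rewrite aval_refl // hx oppr0.
Qed.

Definition adjacent_wall b H0 := valid H0 /\
  forall K, valid K -> ~ same_hyp K H0 -> 0 < aval K b * aval K (refl H0 b).

Lemma adjacent_wall_sym b H0 : adjacent_wall b H0 -> adjacent_wall (refl H0 b) H0.
Proof.
by move=> [r0 h]; split=> // K rK ne; rewrite reflK // mulrC; exact: h.
Qed.

(** The mirrored step is made by the conjugate reflection, whose sign at [c] is that of [K] at the
    mirror image of [c]. *)
Lemma adjacent_wall_step b c z H0 K : apt c -> apt z -> valid H0 ->
  0 < aval K b * aval K c -> 0 < aval K b * aval K (refl H0 c) -> valid K ->
  0 < aval K b * aval K z ->
  based_le c z (refl K z) /\ based_le c (refl H0 z) (refl H0 (refl K z)).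
Proof.
move=> ac az r0 h1 h2 rK h3; split; first by apply: based_le1 => //; exact:
  mul_gt0_trans h3.
have asz := apt_refl H0 az.
have := refl_pull_rho r0 rK asz; rewrite reflK // => <-.
apply: based_le1; first exact: valid_pull_rho.
by rewrite !aval_pull_rho // reflK //; exact: mul_gt0_trans h3.
Qed.

(** The two conclusions are proved together because a step in [H0] itself exchanges them; the sign
    condition at [y] starts the induction. *)
Lemma based_le_pair b c H0 y x : apt c -> apt y -> valid H0 -> aval H0 c != 0 ->
  (forall K, valid K -> ~ same_hyp K H0 ->
     0 < aval K b * aval K c /\ 0 < aval K b * aval K (refl H0 c)) ->
  0 <= aval H0 c * aval H0 y -> based_le b y x -> based_le c y x /\ based_le c y (refl
    H0 x).
Proof.
move=> ac ay r0 nc hc s; elim=> [|z K yz [h1 h2] rK hK].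
  by split; [exact: based_le_refl | exact: based_le1W].
have az := based_le_ap yz ay.
have [e|ne] := pselect (same_hyp K H0).
  by rewrite (same_hyp_reflection e) // reflK.
have [k1 k2] := hc _ rK ne.
have [s1 s2] := adjacent_wall_step ac az r0 k1 k2 rK hK.
by split; [exact: based_le_trans s1|exact: based_le_trans s2].
Qed.

(* The lifting property, for the order based at [b] ... *)
Lemma based_le_low b H0 y x : apt b -> apt y -> adjacent_wall b H0 -> aval H0 b != 0 ->
  0 <= aval H0 b * aval H0 y -> based_le b y x -> based_le b y (refl H0 x).
Proof.
move=> ab ay [r0 h0] n0 s h.
apply: (based_le_pair ab ay r0 n0 _ s h).2 => K rK ne; split; last exact: h0.
have := h0 _ rK ne; rewrite -expr2 exprn_even_gt0 //=.
by apply: contraTneq => ->; rewrite mul0r ltxx.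
Qed.

(* ... and for the change of base from [b] to the adjacent [refl H0 b]. *)
Lemma based_le_cross b H0 y x : apt b -> apt y -> adjacent_wall b H0 -> aval H0 b != 0
  ->
  aval H0 b * aval H0 y <= 0 -> based_le b y x -> based_le (refl H0 b) y x.
Proof.
move=> ab ay [r0 h0] n0 s h.
have n0' : aval H0 (refl H0 b) != 0 by rewrite aval_refl // oppr_eq0.
apply: (based_le_pair (apt_refl _ ab) ay r0 n0' _ _ h).1 => [K rK ne|].
  have hk := h0 _ rK ne; split=> //; rewrite reflK //.
  have := hk; rewrite -expr2 exprn_even_gt0 //=.
  by apply: contraTneq => ->; rewrite mul0r ltxx.
by rewrite aval_refl // mulNr oppr_ge0.
Qed.

(** For the new base the larger of [z] and its reflection is the one on the side of [b], called
    [mx z] below. A step in [H0] leaves [mx z] unchanged, and any other step becomes a chain ending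
    at the new [mx]. *)
Lemma based_le_cross_top b H0 y x : apt b -> apt y -> adjacent_wall b H0 -> aval H0 b
  != 0 ->
  based_le b y x ->
  (0 <= aval H0 b * aval H0 x -> based_le (refl H0 b) y x) /\
  (aval H0 b * aval H0 x <= 0 -> based_le (refl H0 b) y (refl H0 x)).
Proof.
move=> ab ay [r0 h0] n0 yx.
set c := refl H0 b.
have ac : apt c by exact: apt_refl.
have nc : aval H0 c != 0 by rewrite aval_refl // oppr_eq0.
pose mx z := if 0 <= aval H0 b * aval H0 z then z else refl H0 z.
have mxs z : mx (refl H0 z) = mx z.
  rewrite /mx aval_refl // mulrN oppr_ge0.
  case: ltgtP => // h; first by rewrite reflK.
  move/eqP: h; rewrite ?[0 == _]eq_sym mulf_eq0 (negbTE n0) => /eqP h'.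
  by rewrite refl_fix.
have mx1 z : based_le c z (mx z).
  rewrite /mx; case: ifPn => [_|]; first exact: based_le_refl.
  rewrite -ltNge => h; apply: based_le1 => //.
  by rewrite aval_refl // mulNr oppr_gt0.
suff h : based_le c y (mx x).
  split=> h'; first by move: h; rewrite /mx h'.
  move: h; rewrite -mxs /mx ifT // aval_refl // mulrN oppr_ge0 //.
elim: yx => [|z K yz IH rK hK]; first exact: mx1.
have az := based_le_ap yz ay.
have [e|ne] := pselect (same_hyp K H0); first by rewrite (same_hyp_reflection e) // mxs.
have hk := h0 _ rK ne.
have hkk : 0 < aval K b * aval K (refl H0 c).
  rewrite /c reflK // -expr2 exprn_even_gt0 //=.
  by apply: contraTneq hk => ->; rewrite mul0r ltxx.
have [s1 s2] := adjacent_wall_step ac az r0 hk hkk rK hK.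
apply: based_le_trans IH _; rewrite {1}/mx; case: ifP => _.
  exact: based_le_trans s1 (mx1 _).
by apply: based_le_trans s2 _; rewrite -mxs; exact: mx1.
Qed.

End Order.

(** * General position *)

Section GeneralPosition.
Variables (R : realType) (m : nat).
Local Notation V := 'rV[R]_(2 * m).
Local Notation apt := (@apartment R m).
Implicit Types (f g : V -> R) (x y z : V).

Definition affine_fun f := forall x y t, f (x + t *: (y - x)) = f x + t * (f y - f x).

Definition eventually0 (P : R -> bool) := exists2 t0 : R, 0 < t0 & forall t, 0 < t <=
  t0 -> P t.

Lemma eventually0T : eventually0 xpredT.
Proof. by exists 1. Qed.

Lemma eventually0I P Q : eventually0 P -> eventually0 Q -> eventually0 (fun t => P t &&
  Q t).
Proof.
move=> [t1 h1 H1] [t2 h2 H2]; exists (Num.min t1 t2); first by rewrite lt_min h1.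
by move=> t /andP[h]; rewrite le_min => /andP[l1 l2]; rewrite H1 ?h // H2 ?h.
Qed.

Lemma eventually0_gt0 (a c : R) : 0 < a -> eventually0 (fun t => 0 < a + t * c).
Proof.
move=> a0; have c1 : 0 < `|c| + 1 by rewrite ltr_wpDl.
exists (a / (`|c| + 1)); first exact: divr_gt0.
move=> t /andP[t0]; rewrite ler_pdivlMr // => h.
have h1 : 0 <= `|c| + c by rewrite -lerBlDr sub0r -normrN ler_norm.
have := mulr_ge0 (ltW t0) h1.
lra.
Qed.

Lemma eventually0_neq0 (a c : R) : a != 0 -> eventually0 (fun t => a + t * c != 0).
Proof.
rewrite neq_lt => /orP[a0|/(@eventually0_gt0 _ c)[t0 h0 H]]; last first.
  by exists t0 => // t /H /gt_eqF ->.
have [|t0 h0 H] := @eventually0_gt0 (- a) (- c); first by rewrite oppr_gt0.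
by exists t0 => // t /H; rewrite mulrN -opprD oppr_gt0 => /lt_eqF ->.
Qed.

Lemma eventually0_all (J : Type) (s : seq J) (P : J -> R -> bool) (Q : pred J) :
  (forall j, Q j -> eventually0 (P j)) -> all Q s -> eventually0 (fun t => all (P^~ t)
    s).
Proof.
move=> h; elim: s => [|j s IH] /=; first by move=> _; exact: eventually0T.
by case/andP=> /h ? /IH; exact: eventually0I.
Qed.

(** A short move towards a point where the next [g j] is nonzero keeps all the strict inequalities
    and nonvanishing conditions already won. *)
Lemma general_position (I J : finType) (f : I -> V -> R) (g : J -> V -> R) (p : V) :
  apt p -> (forall i, affine_fun (f i)) -> (forall j, affine_fun (g j)) ->
  (forall i, 0 < f i p) -> (forall j, exists2 z, apt z & g j z != 0) ->
  exists p', [/\ apt p', forall i, 0 < f i p' & forall j, g j p' != 0].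
Proof.
move=> ap0 af ag f0 g0.
suff [p' [h1 h2 h3]] : exists p', [/\ apt p', forall i, 0 < f i p' &
    all (fun j => g j p' != 0) (enum J)].
  by exists p'; split=> // j; move/allP: h3; apply; rewrite mem_enum.
elim: (enum J) => [|j s [x [ax fx gx]]]; first by exists p.
have [gj|gj] := eqVneq (g j x) 0; last by exists x; split; rewrite //= gj.
have [z az gz] := g0 j.
have e1 := @eventually0_all I (enum I) (fun i t => 0 < f i (x + t *: (z - x))) xpredT.
have [||t1 t1p H1] := e1.
- by move=> i _; have [t0 ? H] := @eventually0_gt0 _ (f i z - f i x) (fx i);
    exists t0 => // t /H; rewrite af.
- exact/allP.
have [|t2 t2p H2] := eventually0_all (P := fun j t => g j (x + t *: (z - x)) != 0) _ gx.
  by move=> i /(@eventually0_neq0 _ (g i z - g i x))[t0 ? H];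
    exists t0 => // t /H; rewrite ag.
pose t := Num.min t1 t2.
have tp : 0 < t by rewrite lt_min t1p.
exists (x + t *: (z - x)); split; first exact: apt_segment.
  move=> i; have := H1 t; rewrite tp ge_min lexx => /(_ isT)/allP; apply.
  by rewrite mem_enum.
rewrite /= ag gj add0r subr0 mulf_neq0 ?gz ?(gt_eqF tp) //=.
by apply: H2; rewrite tp ge_min lexx orbT.
Qed.

End GeneralPosition.

(** * Walls *)

Section Walls.
Variables (R : realType) (m : nat).
Local Notation V := 'rV[R]_(2 * m).
Local Notation apt := (@apartment R m).
Local Notation affroot := (affroot m).
Local Notation same_hyp := (@same_hyp R m).
Implicit Types (x y z b h f v p : V) (i j k : 'I_(2 * m)).
Implicit Types (H K : affroot) (w : affperm (2 * m)).

Definition regular z := apt z /\ forall H, valid H -> aval H z != 0.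

(** Since roots come in opposite pairs, nonnegativity alone also controls the nonpositive sides and
    the zeros: [z] lies in the closure of the facet of [x]. *)
Definition closed_facet x z := forall H, valid H -> 0 <= aval H x -> 0 <= aval H z.

(** The witness [h] is a point in the relative interior of the face that [H0] cuts out of the closed
    alcove of [b]. *)
Definition is_wall_of b H0 := valid H0 /\ exists h, [/\ apt h, aval H0 h = 0 &
  forall K, valid K -> ~ same_hyp K H0 -> 0 < aval K b * aval K h].

Lemma same_hyp_opp H : same_hyp (affroot_opp H) H.
Proof.
move=> x _; rewrite aval_opp; split=> [/eqP|->]; last exact: oppr0.
by rewrite oppr_eq0 => /eqP.
Qed.

Lemma same_hyp_sym H K : same_hyp H K -> same_hyp K H.
Proof. by move=> e x ax; have := e x ax; tauto. Qed.

Lemma same_hyp_trans H K L : same_hyp H K -> same_hyp K L -> same_hyp H L.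
Proof. by move=> e e' x ax; have := e x ax; have := e' x ax; tauto. Qed.

Lemma wlog_opp (P : affroot -> Prop) b : regular b ->
  (forall H, P (affroot_opp H) -> P H) ->
  (forall H, valid H -> 0 < aval H b -> P H) -> forall H, valid H -> P H.
Proof.
move=> rb hP h H rH; have := rb.2 H rH; rewrite neq_lt => /orP[hb|]; last exact: h.
by apply: hP; apply: h; [exact: affroot_opp_valid | rewrite aval_opp oppr_gt0].
Qed.

(** At [h], which [H0] fixes, both [K] and its mirror image have the sign that they have at [b]. For
    the mirror image the latter is the sign of [K] at the reflected base. *)
Lemma wall_adjacent b H0 : apt b -> is_wall_of b H0 -> adjacent_wall b H0.
Proof.
move=> ab [r0 [h [ah h0 hK]]]; split=> // K rK ne.
have ne' : ~ same_hyp (affroot_pull (rho H0) K) H0 by move=> /(same_hyp_pull_rho r0 rK).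
have := hK _ (valid_pull_rho r0 rK) ne'.
rewrite !aval_pull_rho // (refl_fix h0) mulrC => h1.
by have := hK _ rK ne; rewrite mulrC => h2; exact: mul_gt0_trans h2 h1.
Qed.

(** Where the segment from [x] to [y] meets [H], [K] vanishes too, so the end values of [K] are
    proportional to those of [H]. *)
Lemma same_hyp_sep H K x y : same_hyp K H -> apt x -> apt y ->
  aval K x != 0 -> aval H x * aval H y < 0 -> aval K x * aval K y < 0.
Proof.
move=> e ax ay nx s.
have d0 : aval H x - aval H y != 0.
  by apply: contraTneq s => /eqP; rewrite subr_eq0 => /eqP ->; rewrite -leNgt -expr2
    sqr_ge0.
pose t := aval H x / (aval H x - aval H y).
have : aval H (x + t *: (y - x)) = 0 by rewrite aval_segment /t; field.
move=> /(e _ (apt_segment _ ax ay)).2; rewrite aval_segment /t => h.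
have {h} h : aval K x * aval H y = aval H x * aval K y.
  have -> : aval H x * aval K y = aval K x * aval H y + (aval H x - aval H y) *
     (aval K x + aval H x / (aval H x - aval H y) * (aval K y - aval K x)) by field.
  by rewrite h mulr0 addr0.
have Hx : aval H x != 0 by apply: contraTneq s => ->; rewrite mul0r ltxx.
have Hx2 : 0 < aval H x ^+ 2 by rewrite exprn_even_gt0.
have Kx2 : 0 < aval K x ^+ 2 by rewrite exprn_even_gt0.
rewrite -(pmulr_rlt0 _ Hx2).
have -> : aval H x ^+ 2 * (aval K x * aval K y) =
  aval K x * aval H x * (aval H x * aval K y) by ring.
rewrite -h; have -> : aval K x * aval H x * (aval K x * aval H y) =
  aval K x ^+ 2 * (aval H x * aval H y) by ring.
by rewrite pmulr_rlt0.
Qed.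

Definition validb (ij : 'I_(2 * m) * 'I_(2 * m)) : bool :=
  (ij.2 != ij.1) && (ij.2 != rev_ord ij.1).

Lemma validP H : reflect (valid H) (validb H.1).
Proof.
by apply: (iffP andP) => -[h1 h2]; split; [exact/eqP|exact/eqP|apply/eqP|apply/eqP].
Qed.

(** One integer records the signs of a whole family of parallel hyperplanes, which makes counting
    and minimizing over hyperplanes finite. *)
Definition floor_diff x (ij : 'I_(2 * m) * 'I_(2 * m)) : int :=
  Num.floor (x 0 ij.1 - x 0 ij.2).

Lemma aval_ge0 H x : (0 <= aval H x) = (H.2 <= floor_diff x H.1).
Proof. by rewrite floor_ge_int /aval subr_ge0. Qed.

Lemma aval_lt0 H x : (aval H x < 0) = (floor_diff x H.1 < H.2).
Proof. by rewrite ltNge aval_ge0 -ltNge. Qed.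

Lemma aval_shift ij d e x : aval (ij, d) x = aval (ij, e) x + (e - d)%:~R.
Proof. by rewrite /aval /= rmorphB /=; ring. Qed.

(** The first hyperplane crossed on a straight way to [z] is a wall, provided that no two are
    crossed at once; starting from a generic point [p] of the alcove of [b] ensures this. Among
    parallel hyperplanes only the one nearest to [b] matters. *)
Lemma exists_wall b z : regular b -> regular z ->
  (exists2 H, is_wall_of b H & aval H b * aval H z < 0) \/
  (forall H, valid H -> 0 < aval H b * aval H z).
Proof.
move=> rb rz; have [ab nb] := rb; have [az nz] := rz.
(* The smallest of the parallel roots that are positive at [b]; the opposite pair of indices covers
   the hyperplane on the other side. *)
pose F ij : affroot := (ij, floor_diff b ij).
have Fb ij : validb ij -> 0 < aval (F ij) b.
  by move=> /(validP (F ij)) r; rewrite lt_neqAle eq_sym nb //= aval_ge0.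
have Fle H x : 0 < aval H b -> aval (F H.1) x <= aval H x.
  move=> hb; have := ltW hb; rewrite aval_ge0 => le.
  case: H hb le => ij d /= _ le.
  by rewrite (aval_shift ij d (floor_diff b ij)) lerDl ler0z subr_ge0.
pose cand ij := validb ij && (aval (F ij) z < 0).
pose f ij x := if validb ij then aval (F ij) x else 1.
pose cond (u : ('I_(2 * m) * 'I_(2 * m)) * ('I_(2 * m) * 'I_(2 * m))) :=
  [&& cand u.1, cand u.2 & `[< ~ same_hyp (F u.1) (F u.2) >]].
(* Its vanishing at the starting point would mean that the two hyperplanes are met at the same
   time. *)
pose g u x := if cond u then aval (F u.1) x * aval (F u.2) z - aval (F u.2) x * aval (F
  u.1) z
              else 1.
have [||||p [ap0 fp gp]] := @general_position R m _ _ f g b ab.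
- by move=> ij x y t; rewrite /f; case: ifP => _; [exact: aval_segment|ring].
- by move=> u x y t; rewrite /g; case: ifP => _; rewrite ?aval_segment; ring.
- by move=> ij; rewrite /f; case: ifP => // /Fb.
- move=> u; rewrite /g; case E: (cond u); last first.
    by exists b => //; exact: oner_neq0.
  move: E; rewrite /cond => /and3P[/andP[r1 c1] /andP[r2 c2] /asboolP ne].
  apply/not_exists2P => hx; apply: ne; apply: same_hyp_sym.
  apply: incl_same_hyp; [exact/(validP (F u.1))|exact/(validP (F u.2))|] => x ax h1.
  have [//|/negP] := hx x; rewrite negbK h1 mul0r sub0r oppr_eq0 mulf_eq0.
  by rewrite (lt_eqF c1) orbF => /eqP.
have [cij|nc] := pickP cand; last first.
  right; apply: (wlog_opp rb) => [H|H rH hb]; first by rewrite !aval_opp mulrNN.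
  apply: mulr_gt0 => //; apply: lt_le_trans (Fle H z hb).
  have := nc H.1; rewrite /cand (introT (validP H)) //= => /negbT.
  rewrite -leNgt le_eqVlt => /orP[|//]; rewrite eq_sym => h.
  by have := nz (F H.1) rH; rewrite h.
move=> c0; left.
pose t ij := aval (F ij) p / (aval (F ij) p - aval (F ij) z).
have [ij0 /andP[r0 z0] tmin] := arg_minP t c0.
have fp' ij : validb ij -> 0 < aval (F ij) p by move=> r; have := fp ij; rewrite /f r.
have p0 := fp' _ r0.
have d0 : 0 < aval (F ij0) p - aval (F ij0) z by lra.
pose h := p + t ij0 *: (z - p).
have ah : apt h by exact: apt_segment.
have t0 : 0 < t ij0 by rewrite divr_gt0.
have t1 : t ij0 < 1 by rewrite ltr_pdivrMr // mul1r; lra.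
have h0 : aval (F ij0) h = 0 by rewrite aval_segment /t; field; rewrite gt_eqF.
exists (F ij0); last by rewrite pmulr_rlt0 // Fb.
split; first exact/(validP (F ij0)).
exists h; split=> //.
apply: (wlog_opp rb) => [K hK nK|K rK hb nK].
  rewrite -mulrNN -!aval_opp; apply: hK => e; apply: nK.
  exact: same_hyp_trans (same_hyp_sym (same_hyp_opp K)) e.
apply: mulr_gt0 => //.
have rK' : validb K.1 by exact/validP.
have [e|ne] := pselect (same_hyp (F K.1) (F ij0)).
  have := (e h ah).2 h0.
  case: K rK hb nK rK' e => ij d /= rK hb nK rK' e Fh.
  rewrite (aval_shift ij d (floor_diff b ij)) Fh add0r ltr0z subr_gt0.
  have := ltW hb; rewrite aval_ge0 le_eqVlt => /orP[/eqP /= hd|//].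
  by case: nK; rewrite hd.
apply: lt_le_trans (Fle K h hb).
have P0 := fp' _ rK'.
have [Fz|] := ltP (aval (F K.1) z) 0; last first.
  rewrite le_eqVlt => /orP[|Fz].
    by rewrite eq_sym => Fz; have := nz (F K.1) rK; rewrite Fz.
  rewrite aval_segment; move: (t ij0) t0 t1 => s s0 s1.
  have -> : aval (F K.1) p + s * (aval (F K.1) z - aval (F K.1) p) =
     (1 - s) * aval (F K.1) p + s * aval (F K.1) z by ring.
  by apply: addr_gt0; apply: mulr_gt0 => //; rewrite subr_gt0.
have cK : cand K.1 by rewrite /cand rK'.
have := tmin _ cK; have := gp (K.1, ij0).
rewrite /g /cond /= cK /cand r0 z0 /= ifT; last exact/asboolP.
rewrite aval_segment /t.
move: (aval (F ij0) p) (aval (F ij0) z) (aval (F K.1) p) (aval (F K.1) z) p0 d0 z0 P0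
  Fz => P Z P1 Z1 hP hd hZ hP1 hZ1.
move=> ne1; rewrite ler_pdivrMr // mulrAC ler_pdivlMr; last by lra.
move=> le1.
have -> : P1 + P / (P - Z) * (Z1 - P1) = (P * Z1 - P1 * Z) / (P - Z).
  by field; rewrite gt_eqF.
apply: divr_gt0 => //; rewrite lt_neqAle; apply/andP; split; last by lra.
by apply: contra ne1 => /eqP e; apply/eqP; lra.
Qed.

End Walls.

(** * Deodhar's criterion *)

Section Deodhar.
Variables (R : realType) (m : nat).
Local Notation V := 'rV[R]_(2 * m).
Local Notation apt := (@apartment R m).
Local Notation affroot := (affroot m).
Local Notation same_hyp := (@same_hyp R m).
Implicit Types (x y z b h f v p : V) (i j k : 'I_(2 * m)).
Implicit Types (H K : affroot) (u w g : affperm (2 * m)).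

(* Every hyperplane separating the regular points [b] and [z] counts four times. *)
Definition nsep b z : nat := \sum_(ij | validb ij) `|floor_diff b ij - floor_diff z
  ij|%N.

Lemma ext_rev w : ext_weyl w -> forall i, lin w (rev_ord i) = rev_ord (lin w i).
Proof. by case=> _ []. Qed.

Lemma ext_apt w x : ext_weyl w -> apt x -> apt (aff_act w x).
Proof.
move=> [ct [_ sr]] ax i j; rewrite !aff_actE !sr addrACA -rmorphD /=.
by rewrite (ct i j) rmorphD /= (ax _ (lin w j)) addrACA.
Qed.

Lemma regular_act w x : ext_weyl w -> regular x -> regular (aff_act w x).
Proof.
move=> hw [ax nx]; split; first exact: ext_apt.
by move=> H rH; rewrite aval_pull; apply/nx/affroot_pull_valid => //; exact: ext_rev.
Qed.

Lemma regular_refl H x : valid H -> regular x -> regular (refl H x).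
Proof.
move=> rH [ax nx]; split; first exact: apt_refl.
by move=> K rK; rewrite -aval_pull_rho //; apply/nx/valid_pull_rho.
Qed.

Lemma nsep_act w b z : ext_weyl w -> nsep (aff_act w b) (aff_act w z) = nsep b z.
Proof.
move=> hw; have sr := ext_rev hw.
pose s (ij : 'I_(2 * m) * 'I_(2 * m)) := (lin w ij.1, lin w ij.2).
have s_inj : injective s by move=> [i j] [k l] [] /perm_inj -> /perm_inj ->.
rewrite /nsep [RHS](reindex_inj s_inj); apply: eq_big => [[i j]|[i j] _] /=.
  by rewrite /validb /= -sr !(inj_eq perm_inj).
have e x : floor_diff (aff_act w x) (i, j) =
    transl w 0 i - transl w 0 j + floor_diff x (lin w i, lin w j).
  rewrite /floor_diff /= !aff_actE; apply: floor_def; rewrite !rmorphD !rmorphN /=.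
  have /andP[] := floor_itv (x 0 (lin w i) - x 0 (lin w j)).
  by rewrite rmorphD /= => h1 h2; apply/andP; split; lra.
by rewrite !e; congr `|_|%N; ring.
Qed.

Lemma rho_transl H k : transl (rho H) 0 k = H.2 * corootz H.1.1 H.1.2 0 k.
Proof. by rewrite /=; move: (corootz _ _) => c; rewrite mxE. Qed.

Lemma corootz_rev i j k : corootz i j 0 k + corootz i j 0 (rev_ord k) = 0.
Proof.
by apply: (@intr_inj R); rewrite rmorphD /= !corootzE !corootE !eq_rev_ord !rev_ordK;
  ring.
Qed.

Lemma rev_ord_ltn i : (rev_ord i < m)%N = ~~ (i < m)%N.
Proof. by rewrite /=; have := ltn_ord i; lia. Qed.

(** Exactly one of an index and its dual lies in the first half, so each index is counted twice. The
    factor 2 is the parity required in the coroot lattice. *)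
Lemma sum_corootz i j :
  \sum_(k < 2 * m | (k < m)%N) corootz i j 0 k = 2 * ((i < m)%:R - (j < m)%:R).
Proof.
have dl l : \sum_(k < 2 * m | (k < m)%N) (k == l)%:R = (l < m)%:R :> int.
  rewrite big_mkcond (bigD1 l) //= eqxx big1 ?addr0 ?if_same; first by case: ifP.
  by move=> k /negbTE ->; rewrite if_same.
under eq_bigr do rewrite mxE.
rewrite !big_split /= !sumrN !dl !rev_ord_ltn.
by case: (i < m)%N; case: (j < m)%N.
Qed.

Lemma aff_rho H : valid H -> aff_weyl (rho H).
Proof.
move=> rH; split; last exact: fin_weyl_reflp.
have h k : transl (rho H) 0 k + transl (rho H) 0 (rev_ord k) = 0.
  by rewrite !rho_transl -mulrDr corootz_rev mulr0.
split=> [i j|//|]; first by rewrite !h.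
under eq_bigr do rewrite rho_transl.
by rewrite -mulr_sumr sum_corootz mulrCA dvdz_mulr.
Qed.

Lemma aff_ext w : aff_weyl w -> ext_weyl w.
Proof. by case=> -[]. Qed.

Lemma nsep_refl H x b : valid H -> apt b -> apt x ->
  nsep (refl H b) (refl H x) = nsep b x.
Proof.
by move=> rH ab ax; rewrite -!rhoE // nsep_act //; exact/aff_ext/aff_rho.
Qed.

(** Only [H0] lies between [b] and its mirror image, so each floor moves, if at all, towards that of
    [z]; the direction of [H0] gives the strict decrease. *)
Lemma nsep_wall b z H0 : regular b -> regular z -> adjacent_wall b H0 ->
  aval H0 b * aval H0 z < 0 -> (nsep (refl H0 b) z < nsep b z)%N.
Proof.
move=> rb rz [r0 h0] s; have rsb := regular_refl r0 rb.
have sepb K : valid K -> aval K b * aval K (refl H0 b) < 0 -> aval K b * aval K z < 0.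
  move=> rK s'; have [e|/(h0 _ rK)] := pselect (same_hyp K H0).
    by apply: (same_hyp_sep e rb.1 rz.1) s; exact: rb.2.
  by move/lt_gtF; rewrite s'.
have key ij : validb ij -> (`|floor_diff (refl H0 b) ij - floor_diff z ij| <=
  `|floor_diff b ij - floor_diff z ij|)%N
    /\ (floor_diff (refl H0 b) ij != floor_diff b ij ->
        (`|floor_diff (refl H0 b) ij - floor_diff z ij| < `|floor_diff b ij -
          floor_diff z ij|)%N).
  move=> rij.
  have k1 d : floor_diff b ij < d <= floor_diff (refl H0 b) ij -> d <= floor_diff z ij.
    have rK : valid (ij, d) by apply/(validP (ij, d)).
    rewrite -(aval_lt0 (ij, d)) -(aval_ge0 (ij, d)) -(aval_ge0 (ij, d)) => /andP[h1 h2].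
    have h3 : 0 < aval (ij, d) (refl H0 b) by rewrite lt_neqAle eq_sym (rsb.2 _ rK).
    have := sepb _ rK; rewrite !nmulr_rlt0 // => /(_ h3); exact: ltW.
  have k2 d : floor_diff (refl H0 b) ij < d <= floor_diff b ij -> floor_diff z ij < d.
    have rK : valid (ij, d) by apply/(validP (ij, d)).
    rewrite -(aval_lt0 (ij, d)) -(aval_ge0 (ij, d)) -(aval_lt0 (ij, d)) => /andP[h1 h2].
    have h3 : 0 < aval (ij, d) b by rewrite lt_neqAle eq_sym (rb.2 _ rK).
    by have := sepb _ rK; rewrite !pmulr_rlt0 // => /(_ h1).
  have := k1 (floor_diff (refl H0 b) ij); have := k2 (floor_diff (refl H0 b) ij + 1).
  by move: (floor_diff _ _) (floor_diff _ _) (floor_diff _ _) => e e' e'' {}k1 {}k2;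
    split; lia.
have r0' : validb H0.1 by exact/validP.
rewrite /nsep (bigD1 H0.1) //= [X in (_ < X)%N](bigD1 H0.1) //= -addSn.
apply: leq_add; last by apply: leq_sum => ij /andP[/key[]].
apply: (key _ r0').2; apply: contraTneq s => e; rewrite -leNgt.
have [hb|hb] := ltP (aval H0 b) 0.
  by have := aval_refl b r0; have := hb; rewrite aval_lt0 -e -aval_lt0; lra.
have := rb.2 H0 r0; have := hb; rewrite aval_ge0 -e -aval_ge0 aval_refl // => h1 /eqP;
  lra.
Qed.

Lemma closed_facet_trans x y z : closed_facet x y -> closed_facet y z -> closed_facet x
  z.
Proof. by move=> h h' H rH /(h _ rH)/(h' _ rH). Qed.

Lemma closed_facet_sgn H x z : valid H -> closed_facet x z -> 0 <= aval H x * aval H z.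
Proof.
move=> rH h; have [h1|h1] := leP 0 (aval H x); first by apply: mulr_ge0 => //; exact: h.
have := h _ (affroot_opp_valid rH); rewrite !aval_opp !oppr_ge0 => /(_ (ltW h1)) h2.
by apply: mulr_le0 => //; exact: ltW.
Qed.

Lemma closed_facet_strict H x z c : valid H -> closed_facet x z -> aval H x != 0 -> 0 <
  c * aval H z ->
  0 < c * aval H x.
Proof.
move=> rH h nx h1; have := closed_facet_sgn rH h.
rewrite le_eqVlt => /orP[|h2].
  rewrite eq_sym mulf_eq0 (negbTE nx) => /eqP h2.
  by move: h1; rewrite h2 mulr0 ltxx.
by apply: (@mul_gt0_trans _ (aval H z)); rewrite mulrC.
Qed.

Lemma closed_facet_act w x z : ext_weyl w -> closed_facet x z -> closed_facet (aff_act
  w x) (aff_act w z).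
Proof.
move=> hw h H rH; rewrite !aval_pull; apply: h; apply: affroot_pull_valid => //; exact:
  ext_rev.
Qed.

Lemma based_le_same b c x y :
  (forall H, valid H -> 0 < aval H b * aval H c) -> based_le b x y -> based_le c x y.
Proof.
move=> s; elim=> [|z H _ IH rH hz]; first exact: based_le_refl.
by apply: based_le_step => //; exact: mul_gt0_trans (s _ rH) hz.
Qed.

(** Walk from [b] to [p] through successive walls. Each wall crossed separates the current base from
    [p], so [x] is not on the side being left and [based_le_cross] applies. *)
Lemma based_le_move b p x y : regular b -> regular p -> apt x ->
  (forall H, valid H -> aval H b * aval H p < 0 -> 0 <= aval H p * aval H x) ->
  based_le b x y -> based_le p x y.
Proof.
move=> rb rp ax; have [n] := ubnP (nsep b p); elim: n b rb => // n IH b rb lebn h xy.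
have [[H0 w0 s]|s] := exists_wall rb rp; last exact: based_le_same xy.
have a0 := wall_adjacent rb.1 w0; have r0 := a0.1; have rsb := regular_refl r0 rb.
have lt := nsep_wall rb rp a0 s.
apply: (IH (refl H0 b)) => //.
- by apply: leq_trans lt _.
- move=> H rH s'; apply: h => //; have := rb.2 H rH; rewrite neq_lt => hb.
  have [e|ne] := pselect (same_hyp H H0).
    by apply: (same_hyp_sep e rb.1 rp.1 _ s); exact: rb.2.
  by have := mul_gt0_lt0 (a := aval H (refl H0 b)); apply; rewrite // mulrC; exact:
    a0.2.
apply: based_le_cross => //; [exact: rb.1|exact: rb.2|].
have h1 := h _ r0 s.
rewrite leNgt; apply/negP => h2.
have := mul_gt0_lt0 h2 s; rewrite mulrC; lra.
Qed.

Lemma aff_actM u w x : aff_act (u * w)%g x = aff_act u (aff_act w x).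
Proof.
apply/rowP => k; rewrite !aff_actE permM addrA; congr (_ + _).
by rewrite /= mxE [X in _ + X]mxE rmorphD.
Qed.

Lemma aff_act1 x : aff_act 1%g x = x.
Proof. by apply/rowP => k; rewrite aff_actE perm1 /= mxE add0r. Qed.

Lemma aff_actK w x : aff_act w^-1%g (aff_act w x) = x.
Proof. by rewrite -aff_actM mulVg aff_act1. Qed.

Lemma aff_actKV w x : aff_act w (aff_act w^-1%g x) = x.
Proof. by rewrite -aff_actM mulgV aff_act1. Qed.

Lemma pullK w H : affroot_pull w (affroot_pull w^-1%g H) = H.
Proof.
case: H => [[i j] d]; rewrite /affroot_pull /= !permKV; congr (_, _).
rewrite !mxE; ring.
Qed.

Lemma lin_revV w : (forall i, lin w (rev_ord i) = rev_ord (lin w i)) ->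
  forall i, lin w^-1%g (rev_ord i) = rev_ord (lin w^-1%g i).
Proof. by move=> h i; apply: (@perm_inj _ (lin w)); rewrite h /= !permKV. Qed.

Lemma based_le_act w b x y : (forall i, lin w (rev_ord i) = rev_ord (lin w i)) ->
  based_le b x y -> based_le (aff_act w b) (aff_act w x) (aff_act w y).
Proof.
move=> hw; elim=> [|z H _ IH rH hz]; first exact: based_le_refl.
rewrite -[H](pullK w) -refl_pull //; apply: based_le_step => //.
  by apply: affroot_pull_valid => //; exact: lin_revV.
by rewrite !aval_pull pullK.
Qed.

Lemma ext_mul u w : ext_weyl u -> ext_weyl w -> ext_weyl (u * w)%g.
Proof.
move=> [cu [su ru]] [cw [sw rw]]; split; last first.
  by split=> [|i]; rewrite /= ?odd_permM ?(negbTE su) ?permM ?ru ?rw.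
move=> i j; rewrite /= !mxE addrACA (cu i j) [RHS]addrACA; congr (_ + _).
by rewrite !ru; exact: cw.
Qed.

Lemma aff_act_affine w x y t :
  aff_act w (x + t *: (y - x)) = aff_act w x + t *: (aff_act w y - aff_act w x).
Proof. by apply/rowP => k; rewrite !mxE; ring. Qed.

Lemma closed_facet_neg H x z c : valid H -> closed_facet x z -> c * aval H x < 0 -> c *
  aval H z <= 0.
Proof.
move=> rH h s; rewrite leNgt; apply/negP => s'.
by have := mul_gt0_lt0 s' s; rewrite mulrC ltNge closed_facet_sgn.
Qed.

Lemma closed_facet_pos H x z c : valid H -> closed_facet x z -> 0 < c * aval H x -> 0
  <= c * aval H z.
Proof.
move=> rH h s; rewrite leNgt; apply/negP => s'.
by have := mul_gt0_lt0 s s'; rewrite ltNge closed_facet_sgn.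
Qed.

(* By induction on the distance from [b] to [y]: reflecting in a wall of [b] that
   separates it from [y] brings [y] closer, and both the hypothesis and the
   conclusion are transported by the lifting property. *)
Lemma deodhar b p f (S : V -> Prop) : regular b -> regular p ->
  apt f -> closed_facet p f -> (forall v, S v -> apt v /\ closed_facet p v) ->
  (forall P : V -> Prop, (forall x y t, P x -> P y -> P (x + t *: (y - x))) ->
     (forall v, S v -> P v) -> P f) ->
  forall x y : affperm (2 * m), ext_weyl x -> ext_weyl y ->
  (forall v, S v -> based_le b (aff_act x v) (aff_act y v)) ->
  based_le b (aff_act x f) (aff_act y f).
Proof.
move=> rb rp af cf hS hull.
move=> x y ex ey; have [n] := ubnP (nsep b (aff_act y p)).
elim: n x y ex ey => // n IH x y ex ey leyn hv0.
have ryp := regular_act ey rp; have ryx := regular_act ex rp.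
have avx w v : ext_weyl w -> S v -> apt (aff_act w v).
  by move=> hw /hS[av _]; exact: ext_apt.
have clw w v : ext_weyl w -> S v -> closed_facet (aff_act w p) (aff_act w v).
  by move=> hw /hS[_ cv]; exact: closed_facet_act.
have [[H0 w0 s]|s] := exists_wall rb ryp; last first.
  (* Now [b] and [y p] lie in the same alcove, so each [y v] is minimal and equals [x v]; [hull],
     which puts [f] in the affine span of [S], carries the equality over to [f]. *)
  suff -> : aff_act x f = aff_act y f by exact: based_le_refl.
  apply: (hull (fun v => aff_act x v = aff_act y v)) => [z z' t e e'|v Sv]; first by
    rewrite !aff_act_affine e e'.
  have := hv0 v Sv; move e : (aff_act y v) => yv h.
  case: h e => // z H _ rH hz e.
  have := clw y v ey Sv; rewrite e => c; have := closed_facet_pos rH c (s H rH).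
  by rewrite aval_refl // mulrN oppr_ge0 leNgt hz.
have a0 := wall_adjacent rb.1 w0; have r0 := a0.1; have n0 := rb.2 _ r0.
have ab := rb.1.
have ayf := ext_apt ey af; have axf := ext_apt ex af.
have ext_s w : ext_weyl w -> ext_weyl (rho H0 * w)%g.
  by apply: ext_mul; exact/aff_ext/aff_rho.
have sE w z : ext_weyl w -> apt z -> aff_act (rho H0 * w)%g z = refl H0 (aff_act w z).
  by move=> hw az; rewrite aff_actM rhoE //; exact: ext_apt.
have lt : (nsep b (aff_act (rho H0 * y)%g p) < n)%N.
  rewrite sE //; last exact: rp.1.
  rewrite -[b](reflK _ r0) nsep_refl //; last 2 first.
  - exact: apt_refl.
  - exact: ryp.1.
  by move: leyn; rewrite ltnS; apply: leq_trans; exact: nsep_wall.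
have sle b' z z' : apt b' -> apt z -> apt z' -> based_le b' z z' ->
    based_le (refl H0 b') (refl H0 z) (refl H0 z').
  move=> a1 a2 a3; rewrite -!(rhoE r0) //; apply: based_le_act.
  by move=> i; exact: reflp_rev.
have top : based_le b (refl H0 (aff_act y f)) (aff_act y f).
  rewrite -{2}[aff_act y f](reflK _ r0); apply: based_le1W => //.
  rewrite aval_refl // mulrN oppr_ge0.
  by apply: closed_facet_neg s => //; exact: closed_facet_act.
(* If [x p] is on the side of [b], only [y] is reflected. Otherwise both are, and the conclusion is
   reflected back after a change of base. *)
have [sx|sx] := ltP 0 (aval H0 b * aval H0 (aff_act x p)).
  apply: based_le_trans top; rewrite -sE //; apply: IH => //; first exact: ext_s.
  move=> v Sv; rewrite sE //; last exact: (hS v Sv).1.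
  apply: based_le_low => //; [exact: avx| |exact: hv0].
  exact: closed_facet_pos (clw _ _ ex Sv) sx.
have {}sx : aval H0 b * aval H0 (aff_act x p) < 0.
  by rewrite lt_neqAle sx mulf_neq0 //; exact: ryx.2.
have : based_le b (aff_act (rho H0 * x)%g f) (aff_act (rho H0 * y)%g f).
  apply: IH => //; [exact: ext_s|exact: ext_s|].
  move=> v Sv; have av := (hS v Sv).1; rewrite !sE // -[b](reflK _ r0).
  apply: sle; [exact: apt_refl|exact: avx|exact: avx|].
  apply: based_le_cross => //; [exact: avx| |exact: hv0].
  exact: closed_facet_neg (clw _ _ ex Sv) sx.
rewrite !sE // => h.
have := (based_le_cross_top ab (apt_refl _ axf) a0 n0 h).1.
rewrite aval_refl // mulrN oppr_ge0 => /(_ (closed_facet_neg r0 (closed_facet_act ey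
  cf) s)) h'.
have := sle _ _ _ (apt_refl _ ab) (apt_refl _ axf) (apt_refl _ ayf) h'.
by rewrite !reflK.
Qed.

End Deodhar.

(** * Facets and their closures *)

Section Facets.
Variables (R : realType) (m : nat).
Local Notation V := 'rV[R]_(2 * m).
Local Notation apt := (@apartment R m).
Local Notation affroot := (affroot m).
Local Notation same_hyp := (@same_hyp R m).
Implicit Types (x y z b h f v p : V) (i j k : 'I_(2 * m)).
Implicit Types (H K : affroot) (u w g : affperm (2 * m)).

Definition facet x : set V := [set y | apt y /\ same_facet x y].

Lemma same_facetP x y : same_facet x y <-> closed_facet x y /\ closed_facet y x.
Proof.
split=> [s|[h1 h2] i j d rij].
  have e H : valid H -> (0 <= aval H x) = (0 <= aval H y).
    by move=> rH; rewrite -sgr_ge0 [Num.sg _]s // sgr_ge0.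
  by split=> H rH; rewrite e.
have := h1 (i, j, d) rij; have := h2 (i, j, d) rij.
have := h1 _ (@affroot_opp_valid _ (i, j, d) rij); have := h2 _ (@affroot_opp_valid _
  (i, j, d) rij).
rewrite !aval_opp !oppr_ge0 /aval /=.
move: (_ - _) (_ - _) => a c {}h1 {}h2 h3 h4.
have [a0|a0|a0] := ltgtP a 0.
- have c0 : c < 0 by rewrite ltNge; apply/negP => /h3; rewrite leNgt a0.
  by rewrite !ltr0_sg.
- have c0 : 0 < c by rewrite ltNge; apply/negP => /h1; rewrite leNgt a0.
  by rewrite !gtr0_sg.
suff -> : c = 0 by rewrite a0.
by apply/eqP; rewrite eq_le h2 ?a0 // h4 ?a0.
Qed.

Lemma facet_self x : apt x -> facet x x.
Proof. by move=> ax; split=> // i j d _. Qed.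

Lemma facet_is x : apt x -> is_facet (facet x).
Proof. by move=> ax; exists x. Qed.

Lemma facet_eq x y : apt x -> closed_facet x y -> closed_facet y x -> facet x = facet y.
Proof.
move=> ax h1 h2; apply/seteqP; split=> z [az] /same_facetP[h3 h4]; split=> //;
  apply/same_facetP; split.
- exact: closed_facet_trans h2 h3.
- exact: closed_facet_trans h4 h1.
- exact: closed_facet_trans h1 h3.
- exact: closed_facet_trans h4 h2.
Qed.

Lemma aval_cvg H z : aval H x @[x --> z] --> aval H z.
Proof.
apply: (@cvgB R R _ (nbhs z) _ (fun x : V => x 0 H.1.1 - x 0 H.1.2)
  (fun=> H.2%:~R)); last exact: cvg_cst.
by apply: (@cvgB R R _ (nbhs z) _ (fun x : V => x 0 H.1.1) (fun x => x 0 H.1.2));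
  exact: coord_continuous.
Qed.

Lemma closure_closed_facet (A : set V) x z : (forall y, A y -> closed_facet x y) ->
  closure A z -> closed_facet x z.
Proof.
move=> hA hz H rH hx; rewrite leNgt; apply/negP => hz0.
have : nbhs z (@aval R m H @^-1` [set r | r < 0]).
  by apply: (@aval_cvg H z [set r | r < 0]); exact: lt_nbhsl.
by move=> /hz[y [/hA /(_ H rH hx)]] /=; rewrite leNgt => /negP.
Qed.

(** The points of the segment from [x] to [z], except [z] itself, lie in the facet of [x] and come
    arbitrarily close to [z]. *)
Lemma closed_facet_closure (A : set V) x z : apt x -> apt z -> closed_facet x z ->
  (forall y, apt y -> closed_facet x y -> closed_facet y x -> A y) -> closure A z.
Proof.
move=> ax az c hA B nB.
have lin : (fun t : R => z + t *: (x - z)) t @[t --> (0 : R)] --> z.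
  have : (fun t : R => z + t *: (x - z)) t @[t --> (0 : R)] --> z + (0 : R) *: (x - z).
    by apply: cvgD; [exact: cvg_cst|apply: cvgZr_tmp; exact: cvg_id].
  by rewrite scale0r addr0.
have /nbhs_ballP[e /= e0 he] := lin _ nB.
pose t := Num.min (e / 2) 1.
have t0 : 0 < t by rewrite lt_min ltr01 divr_gt0.
have t1 : t <= 1 by rewrite ge_min lexx orbT.
exists (z + t *: (x - z)); split; last first.
  apply: he; rewrite /ball /= sub0r normrN gtr0_norm //.
  have : t <= e / 2 by rewrite ge_min lexx.
  move/le_lt_trans; apply; lra.
apply: hA; first exact: apt_segment.
  move=> H rH hx; rewrite aval_segment; have hz := c _ rH hx.
  have -> : aval H z + t * (aval H x - aval H z) = (1 - t) * aval H z + t * aval H x by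
    ring.
  by apply: addr_ge0; apply: mulr_ge0 => //; rewrite ?subr_ge0 // ltW.
move=> H rH; apply: contraTT; rewrite -!ltNge aval_segment => hx.
have := c _ (affroot_opp_valid rH); rewrite !aval_opp !oppr_ge0 => /(_ (ltW hx)) hz.
have -> : aval H z + t * (aval H x - aval H z) = - ((1 - t) * - aval H z + t * - aval H
  x) by ring.
rewrite oppr_lt0; apply: ltr_wpDl.
  by apply: mulr_ge0; rewrite ?subr_ge0 ?oppr_ge0.
by apply: mulr_gt0; rewrite ?oppr_gt0.
Qed.

Lemma facet_leP x z : apt x -> apt z -> facet_le (facet z) (facet x) <-> closed_facet x
  z.
Proof.
move=> ax az; split=> [h|c y [ay /same_facetP[h1 h2]]].
  apply: (closure_closed_facet (A := facet x)); first by move=> y [_ /same_facetP[]].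
  exact/h/facet_self.
apply: (closed_facet_closure ax ay); first exact: closed_facet_trans h1.
by move=> t at' h3 h4; split=> //; apply/same_facetP.
Qed.

Lemma closed_facet_eq0 x z H : valid H -> closed_facet x z -> aval H x = 0 -> aval H z
  = 0.
Proof.
move=> rH c e; apply/eqP; rewrite eq_le (c _ rH) ?e // andbT.
have := c _ (affroot_opp_valid rH); rewrite !aval_opp e !oppr0 oppr_ge0; exact.
Qed.

(** The index pairs whose difference is not an integer at [x]. Their number drops on proper
    subfacets and replaces the dimension as induction measure. *)
Definition nonint x : pred ('I_(2 * m) * 'I_(2 * m)) :=
  fun ij => validb ij && (aval (ij, floor_diff x ij) x != 0).

Lemma aval_eq0_floor H x : aval H x = 0 -> floor_diff x H.1 = H.2.
Proof.
move=> e; apply: floor_def; move: e; rewrite /aval => e.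
by apply/andP; split; rewrite ?rmorphD /=; lra.
Qed.

Lemma nonint_lt x z ij : closed_facet x z -> nonint x ij -> ~~ nonint z ij ->
  (#|nonint z| < #|nonint x|)%N.
Proof.
move=> c h1 h2; apply: proper_card; apply/properP; split; last by exists ij.
apply/fintype.subsetP => kl; rewrite !unfold_in /nonint => /andP[r]; rewrite r /=.
apply: contraNneq => e.
have rH : valid (kl, floor_diff x kl) by exact/(validP (kl, floor_diff x kl)).
have e' := closed_facet_eq0 rH c e.
by rewrite (aval_eq0_floor e') e'.
Qed.

(* A point [f] off the vertices lies on a segment joining two points of smaller
   facets of its closed facet: one is [z], the other is where the ray from [z]
   through [f] leaves the closed facet. *)
Lemma facet_hull (P : V -> Prop) f : apt f ->
  (forall x y t, P x -> P y -> P (x + t *: (y - x))) ->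
  (forall v, apt v -> closed_facet f v -> is_minimal_facet (facet v) -> P v) -> P f.
Proof.
move=> af conv; have [n] := ubnP #|nonint f|; elim: n f af => // n IH f af lefn hmin.
have [|nmin] := pselect (is_minimal_facet (facet f)); first exact: hmin.
have [z [az cz ncz]] : exists z, [/\ apt z, closed_facet f z & ~ closed_facet z f].
  apply: contrapT => h; apply: nmin; split; first exact: facet_is.
  move=> _ [z az ->] le; have cz := (facet_leP af az).1 le.
  apply/esym; apply: facet_eq => //; apply: contrapT => ncz; apply: h.
  by exists z.
have [H [rH Hz Hf]] : exists H, [/\ valid H, 0 <= aval H z & aval H f < 0].
  apply: contrapT => h; apply: ncz => H rH Hz; rewrite leNgt; apply/negP => Hf.
  by apply: h; exists H.
have Hz0 : aval H z = 0.
  apply/eqP; rewrite eq_le Hz andbT.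
  by have := cz _ (affroot_opp_valid rH); rewrite !aval_opp !oppr_ge0 => /(_ (ltW Hf)).
pose hf ij x := aval (ij, floor_diff f ij) x.
pose cand ij := validb ij && (hf ij f < hf ij z).
have nint ij : cand ij -> nonint f ij.
  move=> /andP[r lt]; rewrite /nonint r /=; apply: contraTneq lt => e.
  have rij : valid (ij, floor_diff f ij) by exact/(validP (ij, floor_diff f ij)).
  by rewrite /hf e (closed_facet_eq0 rij cz e) ltxx.
have hf0 ij : cand ij -> 0 < hf ij f.
  by move=> /nint /andP[r ne]; rewrite lt_neqAle eq_sym ne aval_ge0 /=.
have hfE ij d x y : hf ij x - hf ij y = aval (ij, d) x - aval (ij, d) y.
  by rewrite /hf /aval /=; ring.
(* The root [H] decreases away from [z], so the ray does leave the closed facet. *)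
have cH : cand H.1.
  rewrite /cand (introT (validP H) rH) /= -subr_gt0 (hfE _ H.2) -surjective_pairing.
  by rewrite Hz0 sub0r oppr_gt0.
(* How far one can go from [f] away from [z] before the difference [ij] falls to its floor. *)
pose t ij := hf ij f / (hf ij z - hf ij f).
have [ij0 c0 tmin] := arg_minP t cH.
have d0 ij : cand ij -> 0 < hf ij z - hf ij f by move=> /andP[_]; rewrite subr_gt0.
have t0 : 0 < t ij0 by apply: divr_gt0; [exact: hf0|exact: d0].
pose u := f + (- t ij0) *: (z - f).
have au : apt u by exact: apt_segment.
have hfu ij : hf ij u = hf ij f - t ij0 * (hf ij z - hf ij f).
  by rewrite /hf /u aval_segment mulNr.
have cu : closed_facet f u.
  move=> [ij d] rK hK.
  have rij : validb ij by exact/(validP (ij, d)).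
  have [le|lt] := leP (hf ij z) (hf ij f).
    rewrite aval_segment mulNr -mulrN opprB -(hfE ij d); apply: addr_ge0 => //.
    by apply: mulr_ge0; [exact: ltW|rewrite subr_ge0].
  have cij : cand ij by rewrite /cand rij.
  have := tmin _ cij; rewrite {2}/t ler_pdivlMr ?d0 // => le1.
  rewrite (aval_shift ij d (floor_diff f ij)) -/(hf ij u) hfu.
  apply: addr_ge0; first by rewrite subr_ge0.
  by rewrite ler0z subr_ge0; move: hK; rewrite aval_ge0.
have Pz : P z.
  apply: IH => //; last by move=> v av cv; apply: hmin => //; exact: closed_facet_trans
    cv.
  rewrite -ltnS; apply: leq_trans lefn.
  apply: nonint_lt cz (nint _ cH) _.
  by rewrite /nonint (aval_eq0_floor Hz0) -surjective_pairing Hz0 eqxx andbF.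
have Pu : P u.
  apply: IH => //; last by move=> v av cv; apply: hmin => //; exact: closed_facet_trans
    cv.
  rewrite -ltnS; apply: leq_trans lefn.
  apply: nonint_lt cu (nint _ c0) _.
  have e : aval (ij0, floor_diff f ij0) u = 0.
    have := hfu ij0; rewrite /t divfK ?subrr // gt_eqF //; exact: d0.
  by rewrite /nonint (aval_eq0_floor e) e eqxx andbF.
have -> : f = u + (t ij0 / (1 + t ij0)) *: (z - u); last exact: conv.
by apply/rowP => k; rewrite /u !mxE; field; rewrite gt_eqF // addr_gt0.
Qed.

End Facets.

(** * The base alcove *)

Section Lattice.
Variable m : nat.
Implicit Types (u w : affperm (2 * m)) (x y : 'rV[int]_(2 * m)) (s : 'S_(2 * m)).

(** Absolute values keep the parity and agree on dual coordinates, so the full sum is twice the half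
    sum. The full sum is visibly invariant under permutations, which may mix the two halves. *)
Lemma coroot_parity x : (forall i, x 0 i + x 0 (rev_ord i) = 0) ->
  (2 %| \sum_(i < 2 * m | (i < m)%N) x 0 i)%Z = (4 %| \sum_i `|x 0 i|)%Z.
Proof.
move=> hx; rewrite [X in (4 %| X)%Z](bigID (fun i : 'I_(2 * m) => (i < m)%N)) /=.
rewrite [X in _ + X](reindex_inj rev_ord_inj).
under [X in _ + X]eq_bigl do rewrite rev_ord_ltn negbK.
set B := \sum_(i < 2 * m | (i < m)%N) `|x 0 i|.
have -> : \sum_(i < 2 * m | (i < m)%N) `|x 0 (rev_ord i)| = B.
  by apply: eq_bigr => i _; rewrite -normrN; congr `|_|; have := hx i; lia.
have : (2 %| B - \sum_(i < 2 * m | (i < m)%N) x 0 i)%Z.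
  rewrite /B -sumrB; apply: (big_ind (fun z => (2 %| z)%Z)) => [//|a c a2 c2|i _].
  - by exact: rpredD.
  - by case: (ler0P (x 0 i)) => _; lia.
move: (\sum_(_ < _ | _) x 0 _) => A; lia.
Qed.

Lemma coroot_perm s x : fin_weyl s -> coroot_lattice x -> coroot_lattice (col_perm s x).
Proof.
move=> [_ sr] [_ h0 p].
have h i : col_perm s x 0 i + col_perm s x 0 (rev_ord i) = 0 by rewrite !mxE sr.
split=> // [i j|]; first by rewrite !h.
move: p; rewrite !coroot_parity // => p.
rewrite (reindex_inj (perm_inj (s := s))) /= in p.
by under eq_bigr do rewrite mxE.
Qed.

Lemma aff_mul u w : aff_weyl u -> aff_weyl w -> aff_weyl (u * w)%g.
Proof.
move=> [cu fu] [cw fw]; split; last first.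
  case: fu fw => su ru [sw rw].
  by split=> [|i]; rewrite /= ?odd_permM ?(negbTE su) ?permM ?ru ?rw.
have [_ h1 p1] := cu; have [_ h2 p2] := coroot_perm fu cw.
have h i : transl (u * w)%g 0 i + transl (u * w)%g 0 (rev_ord i) = 0.
  rewrite /=; move: (col_perm _ _) h2 => c h2.
  by rewrite !mxE addrACA h1 h2 addr0.
split=> // [i j|]; first by rewrite !h.
rewrite /=; move: (col_perm _ _) p2 => c p2.
by under eq_bigr do rewrite mxE; rewrite big_split; exact: rpredD.
Qed.

Lemma fin_weylV s : fin_weyl s -> fin_weyl s^-1%g.
Proof.
move=> [h r]; split=> [|i]; first by rewrite odd_permV.
by apply: (@perm_inj _ s); rewrite r !permKV.
Qed.

Lemma aff_inv w : aff_weyl w -> aff_weyl w^-1%g.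
Proof.
move=> [cw fw]; split; last exact: fin_weylV.
have [_ h2 p2] := coroot_perm (fin_weylV fw) cw.
have e i : transl w^-1%g 0 i = - col_perm (lin w)^-1%g (transl w) 0 i.
  by rewrite /=; move: (col_perm _ _) => c; rewrite mxE.
have h i : transl w^-1%g 0 i + transl w^-1%g 0 (rev_ord i) = 0.
  by rewrite !e -opprD h2 oppr0.
split=> // [i j|]; first by rewrite !h.
by under eq_bigr do rewrite e; rewrite sumrN; exact: rpredNr.
Qed.

Lemma aff_one : aff_weyl (1 : affperm (2 * m))%g.
Proof.
have h i : transl (1 : affperm (2 * m))%g 0 i = 0 by rewrite /= mxE.
split; last by split=> [|i]; rewrite /= ?odd_perm1 ?perm1.
split=> [i j|i|]; rewrite ?h ?addr0 //.
by rewrite big1.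
Qed.

Lemma ext_inv w : ext_weyl w -> ext_weyl w^-1%g.
Proof.
move=> [cw fw]; split; last exact: fin_weylV.
have [_ r] := fin_weylV fw.
by move=> i j; rewrite /= !mxE !r -!opprD (cw _ ((lin w)^-1%g j)).
Qed.

Lemma mono_perm n (s : 'S_n) : (forall i j : 'I_n, (i < j)%N -> (s i < s j)%N) -> s =
  1%g.
Proof.
have le (t : 'S_n) : (forall i j : 'I_n, (i < j)%N -> (t i < t j)%N) -> forall i :
  'I_n, (i <= t i)%N.
  move=> h [k kn]; elim: k kn => [//|k IH] kn.
  have kn' : (k < n)%N by exact: ltnW.
  exact: leq_ltn_trans (IH kn') (h (Ordinal kn') (Ordinal kn) _).
move=> h; apply/permP => i; rewrite perm1; apply/val_inj/eqP; rewrite eqn_leq le //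
  andbT.
have hV (a c : 'I_n) : (a < c)%N -> (s^-1%g a < s^-1%g c)%N.
  move=> ac; rewrite ltnNge leq_eqVlt; apply/negP => /orP[/eqP/val_inj/perm_inj e|/h].
    by move: ac; rewrite e ltnn.
  by rewrite !permKV ltnNge ltnW.
by have := le _ hV (s i); rewrite permK.
Qed.

End Lattice.

(** * Coordinates in the base alcove, and simple transitivity *)

Section Alcove.
Variables (R : realType) (m : nat).
Hypothesis m2 : (2 <= m)%N.
Local Notation V := 'rV[R]_(2 * m).
Local Notation apt := (@apartment R m).
Local Notation alc := (@base_alcove R m).
Implicit Types (x y z p : V) (i j k l : 'I_(2 * m)) (H : affroot m) (w : affperm (2 *
  m)).

(** Pairs up to the middle are given. The others follow by duality, those straddling the middle by
    comparison with the two central coordinates. *)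
Lemma alcove_lt x i j : alc x -> (i < j)%N -> j != rev_ord i -> x 0 i < x 0 j.
Proof.
move=> [ax h1 _] ij ne.
have hj := ltn_ord j; have hi := ltn_ord i.
have ne' : j <> (2 * m - i.+1)%N :> nat by move=> e; case/eqP: ne; exact: val_inj.
have vj : rev_ord j = (2 * m - j.+1)%N :> nat by [].
have vi : rev_ord i = (2 * m - i.+1)%N :> nat by [].
have [im|im] := ltnP i.+1 m.
  have [jm|jm] := leqP j m; first by apply: h1; rewrite ?ij.
  have a1 : (m.-1 < 2 * m)%N by lia.
  have a2 : (m < 2 * m)%N by lia.
  have e : rev_ord (Ordinal a1) = Ordinal a2 by apply: val_inj => /=; lia.
  have b1 : x 0 i < x 0 (Ordinal a1) by apply: h1 => //=; lia.
  have b2 : x 0 (rev_ord j) < x 0 (Ordinal a2) by apply: h1; rewrite /= ?vj; lia.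
  have := ax j (Ordinal a1); rewrite e; lra.
have b : x 0 (rev_ord j) < x 0 (rev_ord i) by apply: h1; lia.
by have := ax i j; lra.
Qed.

Lemma alcove_gap x i j : alc x -> (i < j)%N -> j != rev_ord i -> x 0 j < x 0 i + 1.
Proof.
move=> hx ij ne; have [ax _ h2] := hx.
have hj := ltn_ord j; have hi := ltn_ord i.
have n0 : (0 < 2 * m)%N by lia.
pose bot := Ordinal n0; pose top := rev_ord bot.
have vtop : top = (2 * m - 1)%N :> nat by [].
(* The bound for the last coordinate suffices: duality gives the case of the first index,
   monotonicity the rest. *)
have g l : l != bot -> l != top -> x 0 top - 1 < x 0 l.
  move=> lb lt; have hl := ltn_ord l.
  have lb' : l <> 0%N :> nat by move=> e; case/eqP: lb; exact: val_inj.
  have lt' : l <> (2 * m - 1)%N :> nat by move=> e; case/eqP: lt; exact: val_inj.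
  have [lm|lm] := leqP l m; first by apply: (h2 bot) => //; lia.
  have a1 : (1 < 2 * m)%N by lia.
  have [e|e1] := eqVneq l (rev_ord (Ordinal a1)).
    have e' : l = (2 * m - 2)%N :> nat by rewrite e.
    have a2 : (2 < 2 * m)%N by lia.
    apply: (@lt_trans _ _ (x 0 (Ordinal a2))); first by apply: (h2 bot) => //=; lia.
    apply: alcove_lt => //=; first by lia.
    by apply/eqP => /(congr1 val) /=; lia.
  apply: (@lt_trans _ _ (x 0 (Ordinal a1))); first by apply: (h2 bot) => //=; lia.
  by apply: alcove_lt => //=; lia.
have [i0|i0] := eqVneq i bot.
  have := g (rev_ord j); rewrite i0 in ij ne *.
  have -> : rev_ord j != bot by rewrite eq_rev_ord.
  have -> : rev_ord j != top.
    by rewrite (inj_eq rev_ord_inj); apply: contraTneq ij => ->; rewrite ltnn.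
  move=> /(_ isT isT); have := ax j bot; rewrite -/top; lra.
have gi := g i i0.
have : i != top by apply: contraTneq ij => ->; rewrite vtop; lia.
move=> /gi {}gi; have [->|jt] := eqVneq j top; first by lra.
suff : x 0 j < x 0 top by lra.
apply: alcove_lt => //.
  have : j <> (2 * m - 1)%N :> nat by move=> e; case/eqP: jt; exact: val_inj.
  by rewrite vtop; lia.
by rewrite (inj_eq rev_ord_inj) eq_sym; apply: contraTneq ij => ->; rewrite ltn0.
Qed.

Lemma alcove_sign H x y : alc x -> alc y -> valid H -> 0 < aval H x * aval H y.
Proof.
move=> hx hy; wlog lt : H / (H.1.1 < H.1.2)%N.
  move=> wl rH; have [lt|le] := ltnP H.1.1 H.1.2; first exact: wl.
  have := wl (affroot_opp H); rewrite !aval_opp mulrNN; apply; last exact: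
    affroot_opp_valid.
  rewrite /= ltn_neqAle le andbT.
  by case: rH => h _; apply/eqP => /val_inj.
move=> [_ /eqP ne]; case: H lt ne => [[i j] d] /= ij ne.
have := alcove_lt hx ij ne; have := alcove_gap hx ij ne.
have := alcove_lt hy ij ne; have := alcove_gap hy ij ne.
rewrite /aval /= => h1 h2 h3 h4.
have [d0|d0] := leP 0 d.
  have : 0 <= d%:~R :> R by rewrite ler0z.
  by move=> ?; rewrite nmulr_rgt0; lra.
have : d%:~R <= -1 :> R by rewrite -[X in _ <= X]/((-1)%:~R) ler_int; lia.
by move=> ?; rewrite pmulr_rgt0; lra.
Qed.

Lemma alcove_regular x : alc x -> regular x.
Proof.
move=> hx; split; first by case: hx.
move=> H rH; have := alcove_sign hx hx rH.
by apply: contraTneq => ->; rewrite mul0r ltxx.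
Qed.

Lemma alcove_same x y : alc x -> apt y -> (forall H, valid H -> 0 < aval H x * aval H
  y) -> alc y.
Proof.
move=> hx ay s; have [_ h1 h2] := hx; split=> //.
  move=> k l /andP[kl lm] km.
  have rH : valid (k, l, 0).
    split=> /= e; first by move: kl; rewrite e ltnn.
    by move: lm; rewrite e /=; lia.
  have := s _ rH; rewrite /aval /= !subr0.
  have : x 0 k - x 0 l < 0 by rewrite subr_lt0; apply: h1; rewrite ?kl.
  by move=> h; rewrite nmulr_rgt0 // subr_lt0.
move=> k l k0 /andP[l0 lm].
have rH : valid (rev_ord k, l, 1).
  split=> /= e; first by move: lm; rewrite e /= k0; lia.
  by move: l0; rewrite e rev_ordK k0.
have := s _ rH; rewrite /aval /=.
have : x 0 (rev_ord k) - x 0 l - 1 < 0.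
  by have := h2 k l k0; rewrite l0 lm => /(_ isT); lra.
by move=> h; rewrite nmulr_rgt0 // => h'; lra.
Qed.

Lemma alcove_facet x : alc x -> alc = facet x.
Proof.
move=> hx; have [ax nx] := alcove_regular hx; apply/seteqP; split=> y.
  move=> hy; split; first by case: hy.
  move=> i j d rij; have := alcove_sign hx hy (H := (i, j, d)) rij.
  rewrite /aval /=; move: (x 0 i - x 0 j - _) (y 0 i - y 0 j - _) => a c h.
  have [a0|a0] := ltP a 0.
    by move: h; rewrite nmulr_rgt0 // => c0; rewrite (ltr0_sg a0) (ltr0_sg c0).
  have {}a0 : 0 < a.
    by rewrite lt_neqAle a0 andbT eq_sym; apply: contraTneq h => ->; rewrite mul0r ltxx.
  by move: h; rewrite pmulr_rgt0 // => c0; rewrite (gtr0_sg a0) (gtr0_sg c0).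
move=> [ay s]; apply: (alcove_same hx) => // -[[i j] d] rH.
have := s i j d rH; have := nx (i, j, d) rH; rewrite /aval /=.
move: (x 0 i - x 0 j - _) (y 0 i - y 0 j - _) => a c a0 e.
by rewrite -sgr_gt0 sgrM -e -expr2 exprn_even_gt0 //= sgr_eq0.
Qed.

(* An alcove point with distinct coordinates, all of absolute value below 1/4,
   so that no integral translation is needed to compare them. *)
Definition alcove_point : V :=
  \row_i (((2 * i)%:R - (2 * m - 1)%:R) / (8 * m)%:R).

Lemma alcove_pointB i j :
  alcove_point 0 j - alcove_point 0 i = (j%:R - i%:R) * ((4 * m)%:R^-1).
Proof.
rewrite !mxE !natrM; field; rewrite pnatr_eq0; lia.
Qed.

Lemma alcove_point_rev i : alcove_point 0 (rev_ord i) = - alcove_point 0 i.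
Proof.
rewrite !mxE -mulNr opprB; congr (_ / _) => /=.
have hi := ltn_ord i.
apply/eqP; rewrite subr_eq -addrA [_ + _%:R]addrC addrA eq_sym subr_eq -!natrD.
by apply/eqP; congr _%:R; lia.
Qed.

Lemma alcove_point_lt i : `|alcove_point 0 i| < 4^-1.
Proof.
have hi := ltn_ord i.
have m0 : 0 < m%:R :> R by rewrite ltr0n; lia.
have h1 : i%:R <= (2 * m)%:R - 1 :> R.
  by rewrite lerBrDr natr1 ler_nat.
have h2 : (2 * m - 1)%:R = (2 * m)%:R - 1 :> R by rewrite natrB //; lia.
have h3 : 0 <= i%:R :> R by rewrite ler0n.
rewrite mxE h2 ltr_norml ltr_pdivlMr ?ltr_pdivrMr ?ltr0n; try lia.
by move: h1; rewrite !natrM => h1; apply/andP; split; lra.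
Qed.

Lemma alcove_point_mono i j : (i < j)%N = (alcove_point 0 i < alcove_point 0 j).
Proof.
rewrite -[RHS]subr_gt0 alcove_pointB pmulr_lgt0 ?subr_gt0 ?ltr_nat //.
by rewrite invr_gt0 ltr0n; lia.
Qed.

Lemma alcove_pointP : alc alcove_point.
Proof.
split=> [i j|k l /andP[kl _] _|k l _ _].
- by rewrite !alcove_point_rev !subrr.
- by rewrite -alcove_point_mono.
have := alcove_point_lt (rev_ord k); have := alcove_point_lt l.
by rewrite !ltr_norml => /andP[? ?] /andP[? ?]; lra.
Qed.

Lemma int_lt_half (a c : int) : a%:~R < c%:~R + 2^-1 :> R -> a <= c.
Proof.
move=> h; rewrite -ltzD1 -(ltr_int R) rmorphD /=; lra.
Qed.

(** Coordinates below 1/4 cannot hide an integral translation, and being distinct they reveal the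
    permutation. Group identities are deduced below from equal actions on this one point. *)
Lemma aff_act_inj u w : aff_act u alcove_point = aff_act w alcove_point -> u = w.
Proof.
move=> e.
have ek k : transl u 0 k = transl w 0 k /\ lin u k = lin w k.
  have := congr1 (fun z : V => z 0 k) e; rewrite !aff_actE => h.
  have := alcove_point_lt (lin u k); have := alcove_point_lt (lin w k).
  rewrite !ltr_norml => /andP[? ?] /andP[? ?].
  have et : transl u 0 k = transl w 0 k.
    by apply/eqP; rewrite eq_le; apply/andP; split; apply: int_lt_half; lra.
  split=> //; move: h; rewrite et => /addrI h.
  have := alcove_point_mono (lin u k) (lin w k).
  have := alcove_point_mono (lin w k) (lin u k).
  rewrite h ltxx => h1 h2; apply/val_inj/eqP.
  by rewrite eqn_leq leqNgt h1 leqNgt h2.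
case: u w ek {e} => a s [c t] /= ek; congr AffPerm.
  by apply/rowP => k; case: (ek k).
by apply/permP => k; case: (ek k).
Qed.

(** The alcove inequalities leave two freedoms: a first translation coordinate -1, excluded by the
    parity of the coroot lattice, and an exchange of the two central indices, excluded because the
    permutation is even (the hypothesis locally called [eventually0]). *)
Lemma aff_alcove1 w : aff_weyl w -> alc (aff_act w alcove_point) -> w = 1%g.
Proof.
move=> [[_ n0 par] [eventually0 sr]] hw; apply: aff_act_inj; rewrite aff_act1.
set n := transl w in n0 par; set s := lin w in eventually0 sr.
have bnd k := alcove_point_lt (s k).
have mono k l : (k < l)%N -> l != rev_ord k -> n 0 k <= n 0 l.
  move=> kl ne; have := alcove_lt hw kl ne; rewrite !aff_actE -/n -/s => h.
  have := bnd k; have := bnd l; rewrite !ltr_norml => /andP[? ?] /andP[? ?].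
  by apply: int_lt_half; lra.
have gap k l : (k < l)%N -> l != rev_ord k -> n 0 l <= n 0 k + 1.
  move=> kl ne; have := alcove_gap hw kl ne; rewrite !aff_actE -/n -/s => h.
  have := bnd k; have := bnd l; rewrite !ltr_norml => /andP[? ?] /andP[? ?].
  by apply: int_lt_half; rewrite rmorphD /=; lra.
have n00 : (0 < 2 * m)%N by lia.
pose bot := Ordinal n00.
have mid k : k != bot -> k != rev_ord bot -> n 0 k = 0 /\ -1 <= n 0 bot <= 0.
  move=> kb kt.
  have k0 : (0 < k)%N by rewrite lt0n; apply: contra kb => /eqP e; apply/eqP/val_inj.
  have kt' : (rev_ord k != rev_ord bot) by rewrite (inj_eq rev_ord_inj).
  have kb' : rev_ord k != bot by rewrite eq_rev_ord.
  have k0' : (0 < rev_ord k)%N by rewrite lt0n; apply: contra kb' => /eqP e;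
    apply/eqP/val_inj.
  have h1 := mono bot k k0 kt; have h2 := mono bot (rev_ord k) k0' kt'.
  have lt1 : (k < rev_ord bot)%N by rewrite /=; have := ltn_ord k; move: k0' => /=; lia.
  have lt2 : (rev_ord k < rev_ord bot)%N by rewrite /=; have := ltn_ord k; lia.
  have h3 := gap k (rev_ord bot) lt1; have h4 := gap (rev_ord k) (rev_ord bot) lt2.
  rewrite !(inj_eq rev_ord_inj) eq_sym in h3 h4.
  have := h3 kb; have := h4; rewrite eq_sym kb' => /(_ isT).
  have := n0 k; have := n0 bot; move: h1 h2; lia.
have n1 : (1 < 2 * m)%N by lia.
have [_ nb] : n 0 (Ordinal n1) = 0 /\ -1 <= n 0 bot <= 0.
  by apply: mid => //; apply/eqP => /(congr1 val) /=; lia.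
have nbot : n 0 bot = 0.
  move: par; rewrite (bigD1 bot) /=; last by lia.
  rewrite big1 ?addr0; first by lia.
  move=> k /andP[km kb]; apply: (mid k kb _).1.
  by apply/eqP => e; move: km; rewrite e /=; lia.
have nz k : n 0 k = 0.
  have [->//|kb] := eqVneq k bot; have [->|kt] := eqVneq k (rev_ord bot).
    by have := n0 bot; rewrite nbot add0r.
  exact: (mid k kb kt).1.
have smono k l : (k < l)%N -> l != rev_ord k -> (s k < s l)%N.
  move=> kl ne; rewrite alcove_point_mono.
  by have := alcove_lt hw kl ne; rewrite !aff_actE -/n -/s !nz !add0r.
have nm1 : (m.-1 < 2 * m)%N by lia.
(* The alcove does not order the coordinates at [c] and its dual, the two central indices. *)
pose c := Ordinal nm1.
have smono' k l : (k < l)%N -> k != c -> (s k < s l)%N.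
  move=> kl kc; have [e|] := eqVneq l (rev_ord k); last exact: smono.
  have hk := ltn_ord k.
  have kc' : k <> m.-1 :> nat by move=> e'; case/eqP: kc; exact: val_inj.
  have vl : l = (2 * m - k.+1)%N :> nat by rewrite e.
  have l1 : (k < c)%N by rewrite /=; lia.
  have l2 : (c < l)%N by rewrite /=; lia.
  apply: (@ltn_trans (s c)); apply: smono => //.
    by apply/eqP => /(congr1 val) /=; lia.
  by apply/eqP => /(congr1 val) /=; lia.
suff s1 : s = 1%g.
  by apply/rowP => k; rewrite aff_actE -/n -/s nz s1 perm1 add0r.
have [sc|sc] := ltnP (s c) (s (rev_ord c)).
  apply: mono_perm => k l kl; have [e|] := eqVneq k c; last exact: smono'.
  have [e'|] := eqVneq l (rev_ord k); last exact: smono.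
  by rewrite e' e.
have {}sc : (s (rev_ord c) < s c)%N.
  rewrite ltn_neqAle sc andbT; apply/eqP => /val_inj/perm_inj/eqP.
  by rewrite (negbTE (rev_ord_neq c)).
have vc : rev_ord c = m :> nat by rewrite /=; lia.
suff st : (tperm c (rev_ord c) * s)%g = 1%g.
  have es : s = tperm c (rev_ord c).
    by rewrite -[LHS]mul1g -(tperm2 c (rev_ord c)) -mulgA st mulg1.
  by move: eventually0; rewrite es odd_tperm eq_sym rev_ord_neq.
apply: mono_perm => k l kl; rewrite !permM.
case: (tpermP c (rev_ord c) k) => [e|e|kc kr].
- case: (tpermP c (rev_ord c) l) => [e'|e'|lc lr] //.
    by move: kl; rewrite e e' ltnn.
  have lr' : l <> m :> nat by move=> h; apply: lr; apply: val_inj; exact: etrans h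
    (esym vc).
  apply: smono; first by move: kl; rewrite e /=; lia.
  by rewrite rev_ordK; apply/eqP.
- case: (tpermP c (rev_ord c) l) => [e'|e'|lc lr].
  + by move: kl; rewrite e e' vc /=; lia.
  + by move: kl; rewrite e e' ltnn.
  by apply: smono; [move: kl; rewrite e /=; lia|exact/eqP].
case: (tpermP c (rev_ord c) l) => [e'|e'|lc lr].
- by apply: smono'; [move: kl; rewrite e' /=; lia|exact/eqP].
- apply: smono'; last exact/eqP.
  move: kl; rewrite e' /= => h.
  have kc' : k <> m.-1 :> nat by move=> e''; apply: kc; exact: val_inj.
  lia.
by apply: smono' => //; exact/eqP.
Qed.

End Alcove.

(** * Length and Bruhat order *)

Lemma nat_min (P : nat -> Prop) : (exists n, P n) ->
  exists n, P n /\ forall k, P k -> (n <= k)%N.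
Proof.
move=> [n Pn]; have ex : exists n, `[< P n >] by exists n; apply/asboolP.
case: (ex_minnP ex) => k /asboolP Pk h; exists k; split=> // l Pl.
by apply: h; apply/asboolP.
Qed.

Section Coxeter.
Variables (R : realType) (m : nat).
Hypothesis m2 : (2 <= m)%N.
Local Notation V := 'rV[R]_(2 * m).
Local Notation apt := (@apartment R m).
Local Notation alc := (@base_alcove R m).
Local Notation p0 := (@alcove_point R m).
Local Notation S := (@simple_reflection R m).
Local Notation W := (@aff_weyl m).
Local Notation same_hyp := (@same_hyp R m).
Implicit Types (x y z b f p q : V) (i j : 'I_(2 * m)) (H K : affroot m).
Implicit Types (u w g s t : affperm (2 * m)).

Let rp0 : regular p0 := alcove_regular m2 (alcove_pointP R m2).
Let ap0 : apt p0 := rp0.1.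
Let p0a : alc p0 := alcove_pointP R m2.

Lemma rho_act H w x : valid H -> ext_weyl w -> apt x ->
  aff_act (rho H * w)%g x = refl H (aff_act w x).
Proof. by move=> rH ew ax; rewrite aff_actM rhoE //; exact: ext_apt. Qed.

Lemma rho_ext H : valid H -> ext_weyl (rho H).
Proof. by move=> rH; exact/aff_ext/(aff_rho R). Qed.

Lemma rho2 H : valid H -> (rho H * rho H = 1)%g.
Proof.
move=> rH; apply: (aff_act_inj (R := R) m2).
by rewrite aff_act1 rho_act // ?rhoE ?reflK //; exact: rho_ext.
Qed.

Lemma rhoK H w : valid H -> (rho H * (rho H * w) = w)%g.
Proof. by move=> rH; rewrite mulgA rho2 // mul1g. Qed.

Lemma rho_mulr H w : valid H -> ext_weyl w -> (rho H * w = w * rho (affroot_pull w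
  H))%g.
Proof.
move=> rH ew; have sr := ext_rev ew; apply: (aff_act_inj (R := R) m2).
by rewrite rho_act // aff_actM rhoE ?refl_pull //; exact: affroot_pull_valid.
Qed.

Lemma same_hyp_rho H K : same_hyp K H -> valid H -> valid K -> rho K = rho H.
Proof.
by move=> e rH rK; apply: (aff_act_inj (R := R) m2); rewrite !rhoE //
  (same_hyp_reflection e).
Qed.

Lemma root_hyperplaneP H : valid H -> is_root_hyperplane
  (@root_hyperplane R m H.1.1 H.1.2 H.2).
Proof. by move=> rH; exists H.1.1, H.1.2, H.2. Qed.

Lemma aval_eq0P H x : (aval H x = 0) <-> (x 0 H.1.1 - x 0 H.1.2 = H.2%:~R).
Proof. by rewrite /aval; split=> [/eqP|->]; rewrite ?subrr // subr_eq0 => /eqP. Qed.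

(** No hyperplane other than [H] passes through [h], so the facet of [h] has support [H], as
    [is_wall] demands. *)
Lemma wall_simple H : is_wall_of p0 H -> S (rho H).
Proof.
move=> [rH [h [ah Hh hK]]]; split; first exact: (aff_rho R).
exists H.1.1, H.1.2, H.2; split=> //; last by move=> x ax; exact: rhoE.
split; first exact: root_hyperplaneP.
exists (facet h); split; first exact: facet_is.
  rewrite (alcove_facet m2 p0a); apply/facet_leP => // K rK Kp.
  have [e|ne] := pselect (same_hyp K H); first by rewrite (e h ah).2.
  have {}Kp : 0 < aval K p0 by rewrite lt_neqAle eq_sym (rp0.2 K rK).
  by have := hK _ rK ne; rewrite pmulr_rgt0 // => /ltW.
apply/seteqP; split=> x.
  move=> [ax /(_ _ (root_hyperplaneP rH))]; apply=> y [ay /same_facetP[c _]].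
  by split=> //; apply/aval_eq0P; exact: closed_facet_eq0 rH c Hh.
move=> [ax /aval_eq0P Hx]; split=> // _ [i [j [d [rij ->]]]] sub.
have rK : valid (i, j, d) by [].
have [_ /(aval_eq0P (i, j, d)) Kh] := sub h (facet_self ah).
have [e|ne] := pselect (same_hyp (i, j, d) H).
  by split=> //; apply/(aval_eq0P (i, j, d)); exact/(e x ax).
by have := hK _ rK ne; rewrite Kh mulr0 ltxx.
Qed.

(** A hyperplane through a point of the given face contains its support, hence is the wall itself;
    all others are strictly on one side of that point and [p0]. *)
Lemma simple_wall s : S s -> exists2 H, is_wall_of p0 H & s = rho H.
Proof.
move=> [Ws [i [j [d [rij [_ [_ [[h ah ->] le sup]]] sE]]]]].
pose H : affroot m := (i, j, d).
have rH : valid H by [].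
exists H; last by apply: (aff_act_inj (R := R) m2); rewrite rhoE // sE.
rewrite -/(facet h) in le sup.
have ch : closed_facet p0 h by apply/facet_leP => //; rewrite -(alcove_facet m2 p0a).
have Hh : aval H h = 0.
  suff [_ /(aval_eq0P H)] : root_hyperplane i j d h by [].
  rewrite -sup; split=> // _ [i' [j' [d' [_ ->]]]] sub; apply: sub.
  exact: facet_self.
split=> //; exists h; split=> // K rK ne.
have := closed_facet_sgn rK ch; rewrite le_eqVlt => /orP[|//]; rewrite eq_sym mulf_eq0.
rewrite (negbTE (rp0.2 K rK)) => /eqP Kh; case: ne; apply: incl_same_hyp => // x ax Hx.
have : root_hyperplane i j d x by split=> //; exact/(aval_eq0P H).
rewrite -sup => -[_ /(_ _ (root_hyperplaneP rK))].
move=> sub; apply/aval_eq0P; apply: (sub _).2 => y [ay /same_facetP[c _]].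
by split=> //; apply/aval_eq0P; exact: closed_facet_eq0 rK c Kh.
Qed.

(** Reflecting in separating walls brings [g p0] back into the base alcove, where [aff_alcove1]
    forces the identity. *)
Lemma aff_weyl_word (g : affperm (2 * m)) : W g ->
  exists l : seq (affperm (2 * m)),
    (forall u, u \in l -> S u) /\ g = (\prod_(x <- l) x)%g.
Proof.
have [n] := ubnP (nsep p0 (aff_act g p0)); elim: n g => // n IH g legn Wg.
have eg := aff_ext Wg; have rg := regular_act eg rp0.
have [[H w s]|s] := exists_wall rp0 rg; last first.
  exists [::]; rewrite big_nil; split=> //; apply: (aff_alcove1 (R := R)) => //.
  by apply: alcove_same p0a _ _ => //; exact: rg.1.
have rH := w.1.
have lt : (nsep p0 (aff_act (rho H * g)%g p0) < n)%N.
  rewrite rho_act // -[p0 in nsep p0 _](reflK _ rH) nsep_refl //; [|exact: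
    apt_refl|exact: rg.1].
  by move: legn; rewrite ltnS; apply: leq_trans; apply: nsep_wall => //; exact:
    wall_adjacent.
have [l [hl e]] := IH _ lt (aff_mul (aff_rho R rH) Wg).
exists (rho H :: l); rewrite big_cons -e rhoK //; split=> // u.
by rewrite inE => /orP[/eqP ->|/hl //]; exact: wall_simple.
Qed.

(** The gallery of the word crosses [H]. Either [H] is its first wall, and that letter is deleted,
    or [H] is pulled back through the first letter. The same recursion exhibits [rho H] as a
    conjugate of a simple reflection. *)
Lemma strong_exchange (l : seq (affperm (2 * m))) H : (forall u, u \in l -> S u) ->
  valid H ->
  aval H p0 * aval H (aff_act (\prod_(x <- l) x)%g p0) < 0 ->
  cox_reflection W S (rho H) /\
  exists l', [/\ (size l' < size l)%N, forall u, u \in l' -> S u &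
    (rho H * \prod_(x <- l) x = \prod_(x <- l') x)%g].
Proof.
elim: l H => [|s l IH] H hl rH.
  by rewrite big_nil aff_act1 ltNge -expr2 sqr_ge0.
rewrite !big_cons; set g := (\prod_(x <- l) x)%g => sep.
have Ss : S s by apply: hl; rewrite mem_head.
have hl' u : u \in l -> S u by move=> xl; apply: hl; rewrite inE xl orbT.
have [K wK sK] := simple_wall Ss; have rK := wK.1.
have [_ aK] := wall_adjacent ap0 wK.
have [e|ne] := pselect (same_hyp H K).
  rewrite sK (same_hyp_rho e) //; split.
    exists 1%g, s; split=> //; first exact: aff_one.
    by rewrite mul1g invg1 mulg1 -sK.
  by exists l; split=> //; rewrite rhoK.
have es : ext_weyl s by rewrite sK; exact: rho_ext.
have rH' : valid (affroot_pull s H) by apply: affroot_pull_valid => //; exact: ext_rev.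
have [|[w [s' [Ww Ss' ew]]] [l' [sz hl'' e]]] := IH (affroot_pull s H) hl' rH'.
  rewrite -!aval_pull -aff_actM; apply: mul_gt0_lt0 sep.
  by rewrite sK rhoE //; exact: aK.
have rs : (rho H * s = s * rho (affroot_pull s H))%g by exact: rho_mulr.
split.
  exists (s * w)%g, s'; split=> //.
    by apply: aff_mul => //; rewrite sK; exact: (aff_rho R).
  by rewrite -[LHS](mulgK s) rs ew invMg !mulgA.
exists (s :: l'); split=> //.
  by move=> x; rewrite inE => /orP[/eqP -> //|/hl''].
by rewrite big_cons -e !mulgA rs.
Qed.

Lemma reflection_simple H : valid H -> cox_reflection W S (rho H).
Proof.
move=> rH; have [l [hl e]] := aff_weyl_word (aff_rho R rH).
apply: (strong_exchange hl rH _).1; rewrite -e rhoE // aval_refl // mulrN oppr_lt0.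
by rewrite -expr2 exprn_even_gt0 //=; exact: rp0.2.
Qed.

Lemma cox_lengthP g : W g -> is_word S g (cox_length S g) /\
  forall k, is_word S g k -> (cox_length S g <= k)%N.
Proof.
move=> Wg; apply: (@xgetPex _ 0%N [set k | is_word S g k /\ _]).
apply: nat_min; have [l [hl e]] := aff_weyl_word Wg.
by exists (size l), l.
Qed.

Lemma cox_length_lt g H : W g -> valid H -> aval H p0 * aval H (aff_act g p0) < 0 ->
  (cox_length S (rho H * g)%g < cox_length S g)%N.
Proof.
move=> Wg rH sep; have [[l [sz hl e]] _] := cox_lengthP Wg.
have [_ [l' [sz' hl' e']]] : cox_reflection W S (rho H) /\
  exists l', [/\ (size l' < size l)%N, forall u, u \in l' -> S u &
    (rho H * \prod_(x <- l) x = \prod_(x <- l') x)%g].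
  by apply: strong_exchange => //; rewrite -e.
apply: leq_trans (_ : (size l').+1 <= _)%N; last by rewrite -sz.
rewrite ltnS; apply: (cox_lengthP (aff_mul (aff_rho R rH) Wg)).2.
by exists l'; split=> //; rewrite e.
Qed.

Lemma alcove_act_sign H w z : valid H -> ext_weyl w -> alc z ->
  0 < aval H (aff_act w p0) * aval H (aff_act w z).
Proof.
move=> rH ew az; rewrite !aval_pull; apply: alcove_sign => //.
by apply: affroot_pull_valid => //; exact: ext_rev.
Qed.

(** Extended elements permute the hyperplanes, so one point sent into the alcove takes the whole
    alcove along. *)
Lemma OmegaP t : Omega R t <-> ext_weyl t /\ alc (aff_act t p0).
Proof.
split=> [[et im]|[et at0]]; first by split=> //; rewrite -im; exists p0.
split=> //; apply/seteqP; split=> [_ [z az <-]|z az].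
  apply: (alcove_same m2 at0); first by apply: ext_apt => //; case: az.
  by move=> H rH; exact: alcove_act_sign.
exists (aff_act t^-1%g z); last exact: aff_actKV.
apply: (alcove_same m2 p0a); first by apply: ext_apt (ext_inv et) _; case: az.
move=> H rH; have et' := ext_inv et.
have rH' : valid (affroot_pull t^-1%g H) by apply: affroot_pull_valid => //; exact:
  ext_rev.
rewrite aval_pull -[X in aval X p0](pullK t) -aval_pull; exact: alcove_sign.
Qed.

Lemma ext_decomp w : ext_weyl w -> exists x t : affperm (2 * m), [/\ W x, Omega R t & w
  = (x * t)%g].
Proof.
have [n] := ubnP (nsep p0 (aff_act w p0)); elim: n w => // n IH w legn ew.
have rw := regular_act ew rp0.
have [[H wH s]|s] := exists_wall rp0 rw; last first.
  exists 1%g, w; rewrite mul1g; split=> //; first exact: aff_one.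
  by apply/OmegaP; split=> //; apply: alcove_same p0a _ _ => //; exact: rw.1.
have rH := wH.1.
have lt : (nsep p0 (aff_act (rho H * w)%g p0) < n)%N.
  rewrite rho_act // -[p0 in nsep p0 _](reflK _ rH) nsep_refl //; [|exact:
    apt_refl|exact: rw.1].
  by move: legn; rewrite ltnS; apply: leq_trans; apply: nsep_wall => //; exact:
    wall_adjacent.
have [x [t [Wx Ot e]]] := IH _ lt (ext_mul (rho_ext rH) ew).
exists (rho H * x)%g, t; split=> //; first exact: aff_mul (aff_rho R rH) Wx.
by rewrite -mulgA -e rhoK.
Qed.

(** The quotient of the two affine parts preserves the alcove and is therefore trivial. Thus
    [ext_length] does not depend on the decomposition chosen. *)
Lemma decomp_uniq (x x' t t' : affperm (2 * m)) : W x -> W x' -> Omega R t -> Omega R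
  t' ->
  (x * t = x' * t')%g -> x = x'.
Proof.
move=> Wx Wx' /OmegaP[et at0] /OmegaP[et' at0'] e.
suff : (x'^-1 * x)%g = 1%g by move=> h; rewrite -[x](mulKVg x') h mulg1.
apply: (aff_alcove1 (R := R)) => //; first by apply: aff_mul => //; exact: aff_inv.
have -> : (x'^-1 * x)%g = (t' * t^-1)%g by rewrite -[x](mulgK t) e -mulgA mulKg.
have [_ im] : Omega R (t' * t^-1)%g.
  apply/OmegaP; split; first by apply: ext_mul => //; exact: ext_inv.
  rewrite aff_actM.
  have [_ it] := (OmegaP t).2 (conj et at0).
  have [_ it'] := (OmegaP t').2 (conj et' at0').
  have [z az ez] : (aff_act t @` alc) p0 by rewrite it.
  by rewrite -ez aff_actK -it'; exists z.
by rewrite -im; exists p0.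
Qed.

Lemma ext_lengthE (x t : affperm (2 * m)) : W x -> Omega R t -> ext_length R (x * t)%g
  = cox_length S x.
Proof.
move=> Wx Ot; rewrite /ext_length; case: xgetP => [k _|/(_ (cox_length S x))]; last
  first.
  by case; exists x, t.
by move=> [x' [t' [Wx' Ot' e ->]]]; rewrite (decomp_uniq Wx Wx' Ot Ot' e).
Qed.

Lemma ext_length_lt w H : ext_weyl w -> valid H -> aval H p0 * aval H (aff_act w p0) <
  0 ->
  (ext_length R (rho H * w)%g < ext_length R w)%N.
Proof.
move=> ew rH sep; have [x [t [Wx Ot e]]] := ext_decomp ew.
have WH := aff_mul (aff_rho R rH) Wx.
rewrite e mulgA !ext_lengthE //; apply: cox_length_lt => //.
have /OmegaP[_ at0] := Ot.
have := alcove_act_sign rH (aff_ext Wx) at0; rewrite -aff_actM -e mulrC => h.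
by rewrite mulrC; apply: mul_gt0_lt0 h _; rewrite mulrC.
Qed.

(** Multiplying by a reflection on the right amounts to some [rho H] on the left. If [H] separated
    [p0] from [x p0], the length would drop instead of rising. *)
Lemma bruhat_based_le w w' : ext_bruhat R w w' ->
  [/\ ext_weyl w, exists2 g, W g & w' = (g * w)%g &
      based_le p0 (aff_act w p0) (aff_act w' p0)].
Proof.
move=> [x [x' [t [Wx Wx' Ot [ew ew'] br]]]].
have /OmegaP[et at0] := Ot.
split; first by rewrite ew; apply: ext_mul => //; exact: aff_ext.
  exists (x' * x^-1)%g; first by apply: aff_mul => //; exact: aff_inv.
  by rewrite ew ew' mulgA mulgKV.
rewrite {}ew {}ew'; suff : W x -> W x' /\ based_le p0 (aff_act (x * t)%g p0) (aff_act
  (x' * t)%g p0).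
  by case/(_ Wx).
move: {Wx Wx'} br; elim=> {x x'} [x y st|x|x y z _ IH1 _ IH2] Wx.
- have [r [[w1 [s [Ww Ss er]]] ey len]] := st.
  have [K wK sK] := simple_wall Ss.
  have Wxw : W (x * w1)%g by exact: aff_mul.
  have exw := ext_inv (aff_ext Wxw).
  pose H := affroot_pull (x * w1)^-1%g K.
  have rH : valid H by apply: affroot_pull_valid wK.1; exact: ext_rev.
  have yE : y = (rho H * x)%g.
    have e : (rho H * (x * w1) = x * w1 * rho K)%g.
      by rewrite rho_mulr ?pullK //; exact: aff_ext.
    by rewrite ey er sK !mulgA -e -!mulgA mulgV mulg1.
  have Wy : W y by rewrite yE; exact: aff_mul (aff_rho R rH) Wx.
  split=> //; rewrite yE -mulgA rho_act //; last by apply: ext_mul => //; exact: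
    aff_ext.
  apply: based_le1 => //; rewrite aff_actM.
  have ex := aff_ext Wx.
  have sx := alcove_act_sign rH ex at0.
  suff : 0 < aval H p0 * aval H (aff_act x p0).
    by move=> h; rewrite mulrC; apply: (@mul_gt0_trans _ (aval H (aff_act x p0)));
      rewrite // mulrC.
  rewrite ltNge le_eqVlt; apply/negP => /orP[|sep].
    by rewrite mulf_eq0 (negbTE (rp0.2 H rH)) (negbTE ((regular_act ex rp0).2 H rH)).
  by have := cox_length_lt Wx rH sep; rewrite -yE ltnNge ltnW.
- by split=> //; exact: based_le_refl.
have [Wy h1] := IH1 Wx; have [Wz h2] := IH2 Wy; split=> //; exact: based_le_trans h1 h2.
Qed.

(** Each step of points is made by some [rho H] on the left, which is a conjugate reflection on the
    right, and [cox_length_lt] makes the length increase. *)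
Lemma based_le_bruhat w g : ext_weyl w -> W g ->
  based_le p0 (aff_act w p0) (aff_act (g * w)%g p0) -> ext_bruhat R w (g * w)%g.
Proof.
move=> ew Wg; have [x [t [Wx Ot e]]] := ext_decomp ew.
have /OmegaP[et at0] := Ot.
suff main q : based_le p0 (aff_act w p0) q -> exists x' : affperm (2 * m), [/\ W x',
    q = aff_act (x' * t)%g p0 & cox_bruhat W S x x'].
  move=> /main[x' [Wx' ex' br]]; exists x, x', t; split=> //; split=> //.
  exact: (aff_act_inj (R := R) m2).
elim=> [|z H _ [x' [Wx' -> br]] rH s].
  by exists x; split=> //; [rewrite e|exact: rt_refl].
have WH := aff_mul (aff_rho R rH) Wx'.
exists (rho H * x')%g; split=> //.
  by rewrite -mulgA rho_act //; apply: ext_mul => //; exact: aff_ext.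
apply: rt_trans br _; apply: rt_step.
have [w1 [s1 [Ww Ss er]]] := reflection_simple rH.
have ex' := aff_ext Wx'.
exists (x'^-1 * rho H * x')%g; split.
- exists (x'^-1 * w1)%g, s1; split=> //; first by apply: aff_mul => //; exact: aff_inv.
  by rewrite er invMg invgK !mulgA.
- by rewrite !mulgA mulgV mul1g.
rewrite -{1}[x'](rhoK _ rH); apply: cox_length_lt => //.
rewrite rho_act // aval_refl // mulrN oppr_lt0.
have := alcove_act_sign rH ex' at0; rewrite -aff_actM mulrC => h.
by rewrite mulrC; apply: mul_gt0_trans h _; rewrite mulrC.
Qed.

(** * Passing between chains of alcove points and chains of facet points *)

Section Lifting.
Variables (b p f : V).
Hypotheses (rp : regular p) (af : apt f) (cf : closed_facet p f).

(** The reflections of a chain starting at [w p] multiply to one element [g]; at a point of the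
    closure each step stays a step or becomes trivial. *)
Lemma based_le_chain w q : ext_weyl w -> based_le b (aff_act w p) q ->
  exists g, [/\ W g, q = aff_act (g * w)%g p &
    forall y, apt y -> closed_facet p y -> based_le b (aff_act w y) (aff_act (g * w)%g
      y)].
Proof.
move=> ew; elim=> [|z H _ [g [Wg -> hg]] rH s].
  by exists 1%g; rewrite mul1g; split=> // [|y _ _]; [exact: aff_one|exact:
    based_le_refl].
have egw := ext_mul (aff_ext Wg) ew; have ap' := rp.1.
exists (rho H * g)%g; rewrite -mulgA rho_act //; split=> //.
  exact: aff_mul (aff_rho R rH) Wg.
move=> y ay cy; rewrite rho_act //; apply: based_le_trans (hg y ay cy) _.
apply: based_le1W => //; first exact: closed_facet_pos rH (closed_facet_act egw cy) s.
by apply: contraTneq s => ->; rewrite mul0r ltxx.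
Qed.

(** A strict sign at the facet point is shared by the nearby alcove point, so each step lifts. *)
Lemma based_le_lift_bot w q : ext_weyl w -> based_le b (aff_act w f) q ->
  exists g, [/\ W g, q = aff_act (g * w)%g f &
    based_le b (aff_act w p) (aff_act (g * w)%g p)].
Proof.
move=> ew; elim=> [|z H _ [g [Wg -> hg]] rH s].
  by exists 1%g; rewrite mul1g; split=> //; [exact: aff_one|exact: based_le_refl].
have egw := ext_mul (aff_ext Wg) ew; have ap' := rp.1.
exists (rho H * g)%g; rewrite -mulgA !rho_act //; split=> //.
  exact: aff_mul (aff_rho R rH) Wg.
by apply: based_le_step (hg) (rH) _; apply: closed_facet_strict (rH) (closed_facet_act
  egw cf) _ s;
  exact: (regular_act egw rp).2.
Qed.

(** The same lifting with the upper end prescribed, reading the chain from its last step. *)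
Lemma based_le_lift_top w q : ext_weyl w -> based_le b q (aff_act w f) ->
  exists g, [/\ W g, q = aff_act (g * w)%g f &
    based_le b (aff_act (g * w)%g p) (aff_act w p)].
Proof.
move e : (aff_act w f) => y ew h; have ap' := rp.1.
elim: h w e ew => [|z H _ IH rH s] w e ew.
  by exists 1%g; rewrite mul1g; split=> //; [exact: aff_one|exact: based_le_refl].
have eHw := ext_mul (rho_ext rH) ew.
have ez : aff_act (rho H * w)%g f = z by rewrite rho_act // e reflK.
have [g [Wg -> hg]] := IH _ ez eHw.
exists (g * rho H)%g; split; rewrite -?mulgA //.
  exact: aff_mul Wg (aff_rho R rH).
apply: based_le_trans hg _.
rewrite -{2}[w](rhoK _ rH) [X in based_le _ _ X]rho_act //; apply: based_le1 => //.
have c : closed_facet (aff_act (rho H * w)%g p) z by rewrite -ez; exact: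
  closed_facet_act.
by apply: closed_facet_strict (rH) c _ s; exact: (regular_act eHw rp).2.
Qed.

End Lifting.

End Coxeter.

(** * Facet stabilizers and double cosets *)

Section DoubleCosets.
Variables (R : realType) (m : nat).
Hypothesis m2 : (2 <= m)%N.
Local Notation V := 'rV[R]_(2 * m).
Local Notation apt := (@apartment R m).
Local Notation alc := (@base_alcove R m).
Local Notation p0 := (@alcove_point R m).
Local Notation W := (@aff_weyl m).
Implicit Types (f x y z : V) (H K : affroot m) (a b g t u w : affperm (2 * m)).

Let rp0 : regular p0 := alcove_regular m2 (alcove_pointP R m2).
Let ap0 : apt p0 := rp0.1.
Let p0a : alc p0 := alcove_pointP R m2.

Definition fixer f w := W w /\ aff_act w f = f.

Lemma fixer1 f : fixer f 1%g.
Proof. by split; [exact: aff_one|exact: aff_act1]. Qed.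

Lemma fixerM f u w : fixer f u -> fixer f w -> fixer f (u * w)%g.
Proof.
by move=> [Wu hu] [Ww hw]; split; [exact: aff_mul|rewrite aff_actM hw hu].
Qed.

Lemma fixerV f w : fixer f w -> fixer f w^-1%g.
Proof. by move=> [Ww hw]; split; [exact: aff_inv|rewrite -{1}hw aff_actK]. Qed.

Lemma sep_wall_fix H x y f : valid H -> closed_facet x f -> closed_facet y f ->
  aval H x * aval H y < 0 -> aval H f = 0.
Proof.
move=> rH cx cy s; apply/eqP; apply: contraTT s => nf; rewrite -leNgt.
have h z : closed_facet z f -> 0 <= aval H f * aval H z by move=> c; rewrite mulrC
  closed_facet_sgn.
have f2 : 0 < aval H f ^+ 2 by rewrite exprn_even_gt0.
rewrite -(pmulr_rge0 _ f2).
have -> : aval H f ^+ 2 * (aval H x * aval H y) =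
  (aval H f * aval H x) * (aval H f * aval H y) by ring.
by apply: mulr_ge0; exact: h.
Qed.

Lemma nsep_rho w H : ext_weyl w -> is_wall_of p0 H ->
  aval H p0 * aval H (aff_act w p0) < 0 ->
  (nsep p0 (aff_act (rho H * w)%g p0) < nsep p0 (aff_act w p0))%N.
Proof.
move=> ew wH s; have rH := wH.1; have rw := regular_act ew rp0.
rewrite rho_act // -[p0 in (nsep p0 _ < _)%N](reflK _ rH) nsep_refl //;
  [|exact: apt_refl|exact: rw.1].
by apply: nsep_wall => //; exact: wall_adjacent.
Qed.

(** A wall separating [p0] from [w p0] contains [w f], so reflecting in it shortens [w] without
    moving [w f]. *)
Lemma closed_alcove_inj f w : apt f -> closed_facet p0 f -> W w -> closed_facet p0
  (aff_act w f) ->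
  aff_act w f = f.
Proof.
move=> af cf; have [n] := ubnP (nsep p0 (aff_act w p0)).
elim: n w => // n IH w lewn Ww cw.
have ew := aff_ext Ww; have rw := regular_act ew rp0.
have [[H wH s]|s] := exists_wall rp0 rw; last first.
  rewrite (aff_alcove1 (R := R) m2 Ww) ?aff_act1 //.
  by apply: alcove_same p0a _ _ => //; exact: rw.1.
have rH := wH.1.
have Hf := sep_wall_fix rH cw (closed_facet_act ew cf) s.
have e : aff_act (rho H * w)%g f = aff_act w f by rewrite rho_act // refl_fix.
rewrite -e; apply: IH; last by rewrite e.
  by move: lewn; rewrite ltnS; apply: leq_trans; exact: nsep_rho.
exact: aff_mul (aff_rho R rH) Ww.
Qed.

(** A wall separating [p0] from [w p0] contains [f], so the reflections in the walls through [f]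
    generate its fixer. *)
Lemma fixer_ind f (P : affperm (2 * m) -> Prop) : apt f -> closed_facet p0 f -> P 1%g ->
  (forall H w, is_wall_of p0 H -> aval H f = 0 -> fixer f w -> P w -> P (rho H * w)%g)
    ->
  forall w, fixer f w -> P w.
Proof.
move=> af cf P1 Ps w; have [n] := ubnP (nsep p0 (aff_act w p0)).
elim: n w => // n IH w lewn [Ww hw].
have ew := aff_ext Ww; have rw := regular_act ew rp0.
have [[H wH s]|s] := exists_wall rp0 rw; last first.
  rewrite (aff_alcove1 (R := R) m2 Ww) //.
  by apply: alcove_same p0a _ _ => //; exact: rw.1.
have rH := wH.1.
have cw : closed_facet (aff_act w p0) f by rewrite -hw; exact: closed_facet_act.
have Hf := sep_wall_fix rH cf cw s.
have fw : fixer f (rho H * w)%g.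
  by split; [exact: aff_mul (aff_rho R rH) Ww|rewrite rho_act // hw refl_fix].
rewrite -(rhoK R m2 w rH); apply: Ps => //; apply: IH => //.
by move: lewn; rewrite ltnS; apply: leq_trans; exact: nsep_rho.
Qed.

Lemma fixer_closed_facet f w y : apt f -> closed_facet p0 f -> fixer f w -> apt y ->
  closed_facet f y ->
  aff_act w y = y.
Proof.
move=> af cf + ay cy; move: w; apply: fixer_ind => //; first exact: aff_act1.
move=> H w wH Hf [Ww _] e; rewrite rho_act //; last exact: aff_ext.
  by rewrite e refl_fix //; exact: closed_facet_eq0 wH.1 cy Hf.
exact: wH.1.
Qed.

Lemma fixer_sub f y w : apt f -> closed_facet p0 f -> apt y -> closed_facet f y ->
  fixer f w -> fixer y w.
Proof. by move=> af cf ay cy fw; split; [case: fw|exact: fixer_closed_facet fw _ _].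
  Qed.

Lemma facet_stabP f w : apt f -> closed_facet p0 f -> facet_stab (facet f) w <-> fixer
  f w.
Proof.
move=> af cf; split=> [[Ww im]|fw].
  split=> //; apply: closed_alcove_inj => //.
  have : facet f (aff_act w f) by rewrite -im; exists f => //; exact: facet_self.
  by move=> [_ /same_facetP[c _]]; exact: closed_facet_trans cf c.
split; first by case: fw.
have h y : facet f y -> aff_act w y = y.
  by move=> [ay /same_facetP[c _]]; exact: fixer_closed_facet fw _ _.
apply/seteqP; split=> y; first by move=> [z hz <-]; rewrite h.
by move=> hy; exists y => //; exact: h.
Qed.

(** On generators: conjugation carries the reflection in a hyperplane to the reflection in its
    image. *)
Lemma aff_conj w g : ext_weyl w -> W g -> W (w * g * w^-1)%g.
Proof.
move=> ew Wg; have [l [hl ->]] := aff_weyl_word R m2 Wg.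
elim: l hl => [|s l IH] hl; first by rewrite big_nil mulg1 mulgV; exact: aff_one.
rewrite big_cons; have [|K wK sK] := @simple_wall R m m2 s.
  by apply: hl; rewrite mem_head.
set h := (\prod_(x <- l) x)%g in IH *.
have -> : (w * (s * h) * w^-1)%g = (w * s * w^-1 * (w * h * w^-1))%g.
  by rewrite !mulgA mulgKV.
apply: aff_mul; last by apply: IH => u ul; apply: hl; rewrite inE ul orbT.
have ewV := ext_inv ew.
have rH : valid (affroot_pull w^-1%g K) by apply: affroot_pull_valid wK.1; exact:
  ext_rev.
have := rho_mulr R m2 rH ew; rewrite pullK -sK => <-.
by rewrite mulgK; exact: (aff_rho R).
Qed.

Lemma aff_conjV w g : ext_weyl w -> W g -> W (w^-1 * g * w)%g.
Proof. by move=> /ext_inv ew /(aff_conj ew); rewrite invgK. Qed.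

Definition same_coset (w z : affperm (2 * m)) := exists2 g, W g & z = (g * w)%g.

Lemma same_coset_trans u w (z : affperm (2 * m)) : same_coset u w -> same_coset w z ->
  same_coset u z.
Proof.
move=> [g Wg ->] [h Wh ->]; exists (h * g)%g; first exact: aff_mul.
by rewrite mulgA.
Qed.

Lemma same_coset_fix w a b : ext_weyl w -> W a -> W b -> same_coset w (a * w * b)%g.
Proof.
move=> ew Wa Wb; exists (a * (w * b * w^-1))%g.
  by apply: aff_mul => //; exact: aff_conj.
by rewrite !mulgA mulgKV.
Qed.

(** * Minimal representatives of double cosets *)

Section Reduced.
Variables (f1 f2 : V).
Hypotheses (af1 : apt f1) (af2 : apt f2) (cf1 : closed_facet p0 f1) (cf2 : closed_facet
  p0 f2).

(** Geometric forms of minimality under left factors fixing [f1] and right factors fixing [f2];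
    [min_length_reduced] derives both from minimal length. *)
Definition reduced_l w := forall H, valid H -> aval H f1 = 0 ->
  0 < aval H p0 * aval H (aff_act w p0).
Definition reduced_r w := forall H, valid H -> aval H (aff_act w f2) = 0 ->
  0 < aval H p0 * aval H (aff_act w p0).

(** A hyperplane through [w f2] separating [p0] from [w b p0] allows a shorter [b]. If there is
    none, [w p0] and [w b p0] share an alcove and [b] is trivial. *)
Lemma reduced_r_le w b : ext_weyl w -> reduced_r w -> fixer f2 b ->
  based_le p0 (aff_act w p0) (aff_act (w * b)%g p0).
Proof.
move=> ew red; have [n] := ubnP (ext_length R (w * b)%g).
elim: n b => // n IH b lebn [Wb hb].
have ewb : ext_weyl (w * b)%g by apply: ext_mul => //; exact: aff_ext.
have rwb := regular_act ewb rp0; have rw := regular_act ew rp0.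
have hwb : aff_act (w * b)%g f2 = aff_act w f2 by rewrite aff_actM hb.
have [[H [rH Hf s]]|nH] := pselect (exists H, [/\ valid H, aval H (aff_act w f2) = 0 &
    aval H p0 * aval H (aff_act (w * b)%g p0) < 0]).
  have rK : valid (affroot_pull w H) by apply: affroot_pull_valid => //; exact: ext_rev.
  have e : (w * (rho (affroot_pull w H) * b) = rho H * (w * b))%g.
    by rewrite mulgA -(rho_mulr R m2) // mulgA.
  have lt : (ext_length R (w * (rho (affroot_pull w H) * b))%g < n)%N.
    rewrite e; move: lebn; rewrite ltnS; apply: leq_trans.
    exact: ext_length_lt.
  have fb : fixer f2 (rho (affroot_pull w H) * b)%g.
    split; first exact: aff_mul (aff_rho R rK) Wb.
    rewrite rho_act //; last exact: aff_ext.
    by rewrite hb refl_fix // -aval_pull.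
  apply: based_le_trans (IH _ lt fb) _.
  rewrite e rho_act // -{2}[aff_act (w * b)%g p0](reflK _ rH).
  by apply: based_le1 => //; rewrite aval_refl // mulrN oppr_gt0.
suff -> : b = 1%g by rewrite mulg1; exact: based_le_refl.
apply: (aff_alcove1 (R := R) m2 Wb); apply: (alcove_same m2 p0a).
  by apply: ext_apt => //; exact: aff_ext.
move=> K rK; have ewV := ext_inv ew.
pose H := affroot_pull w^-1%g K.
have rH : valid H by apply: affroot_pull_valid => //; exact: ext_rev.
have e y : aval K y = aval H (aff_act w y) by rewrite aval_pull pullK.
rewrite !e -aff_actM.
have [Hf|Hf] := eqVneq (aval H (aff_act w f2)) 0.
  apply: (@mul_gt0_trans _ (aval H p0)); first exact: red H rH Hf.
  rewrite lt_neqAle eq_sym mulf_neq0 ?(rp0.2 H rH) ?(rwb.2 H rH) //= leNgt.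
  by apply/negP => s; apply: nH; exists H.
have c1 : closed_facet (aff_act w p0) (aff_act w f2) by exact: closed_facet_act.
have c2 : closed_facet (aff_act (w * b)%g p0) (aff_act w f2) by rewrite -hwb; exact:
  closed_facet_act.
apply: (@mul_gt0_trans _ (aval H (aff_act w f2))); rewrite mulrC lt_neqAle eq_sym.
  by rewrite mulf_neq0 ?(rw.2 H rH) //= closed_facet_sgn.
by rewrite mulf_neq0 ?(rwb.2 H rH) //= closed_facet_sgn.
Qed.

(** The right factor is absorbed by descending to [f2], where it is invisible, and lifting with
    upper end [z b]. The left factor is built from walls through [f1], one lifting step for each. *)
Lemma reduced_le w (z : affperm (2 * m)) a b : ext_weyl w -> reduced_l w -> reduced_r w
  ->
  same_coset w z -> based_le p0 (aff_act w p0) (aff_act z p0) ->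
  fixer f1 a -> fixer f2 b -> based_le p0 (aff_act w p0) (aff_act (a * z * b)%g p0).
Proof.
move=> ew redl redr [g Wg ez] wz fa fb; have [Wb hb] := fb.
have ez' : ext_weyl z by rewrite ez; apply: ext_mul => //; exact: aff_ext.
have ezb : ext_weyl (z * b)%g by apply: ext_mul => //; exact: aff_ext.
have wzb : based_le p0 (aff_act w p0) (aff_act (z * b)%g p0).
  have [g' [_ e h]] := based_le_chain rp0 ew wz.
  have := h f2 af2 cf2; rewrite -(aff_act_inj m2 e).
  have -> : aff_act z f2 = aff_act (z * b)%g f2 by rewrite aff_actM hb.
  move=> /(based_le_lift_top m2 rp0 af2 cf2 ezb)[g2 [Wg2 e2 h2]].
  (* The lifted lower end agrees with [w] on [f2], so it is [w] times an element of the fixer. *)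
  have fb' : fixer f2 (w^-1 * (g2 * z * b))%g.
    split; last by rewrite aff_actM -mulgA -e2 aff_actK.
    have -> : (w^-1 * (g2 * z * b) = w^-1 * (g2 * g) * w * b)%g.
      by rewrite ez !mulgA.
    by apply: aff_mul => //; apply: aff_conjV => //; exact: aff_mul.
  have := reduced_r_le ew redr fb'; rewrite mulKVg -mulgA => h3.
  exact: based_le_trans h3 h2.
rewrite -mulgA; move: a fa; apply: fixer_ind => //; first by rewrite mul1g.
move=> H a wH Hf [Wa _] IH; have rH := wH.1.
have ea : ext_weyl (a * (z * b))%g by apply: ext_mul => //; exact: aff_ext.
rewrite -mulgA rho_act //; apply: based_le_low => //.
- exact: ext_apt.
- exact: wall_adjacent.
- exact: rp0.2.
- exact/ltW/redl.
Qed.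

Lemma double_cosetP w (z : affperm (2 * m)) : double_coset (facet f1) w (facet f2) z <->
  exists a b, [/\ fixer f1 a, fixer f2 b & z = (a * w * b)%g].
Proof.
split=> [[a [_ [b [/(facet_stabP _ af1 cf1) ha -> /(facet_stabP _ af2 cf2) hb ->]]]]|].
  by exists a, b.
move=> [a [b [ha hb ->]]]; exists a, w, b; split=> //; exact/facet_stabP.
Qed.

Lemma min_length_reduced w0 w : ext_weyl w0 ->
  is_min_length R (double_coset (facet f1) w0 (facet f2)) w ->
  [/\ ext_weyl w, reduced_l w & reduced_r w].
Proof.
move=> ew0 [/double_cosetP[a [b [fa fb ew]]] wmin].
have ew' : ext_weyl w.
  by rewrite ew; apply: ext_mul; [apply: ext_mul|]; rewrite //;
    [case: fa => /aff_ext|case: fb => /aff_ext].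
have rw := regular_act ew' rp0.
have key H : valid H -> double_coset (facet f1) w0 (facet f2) (rho H * w)%g ->
    0 < aval H p0 * aval H (aff_act w p0).
  move=> rH inD; rewrite lt_neqAle eq_sym mulf_neq0 ?(rp0.2 H rH) ?(rw.2 H rH) //=.
  rewrite leNgt; apply/negP => s.
  by have := wmin _ inD; rewrite leqNgt ext_length_lt.
split=> // H rH Hf; apply: key => //; apply/double_cosetP.
  exists (rho H * a)%g, b; split=> //; last by rewrite ew !mulgA.
  apply: fixerM => //; split; first exact: (aff_rho R).
  by rewrite rhoE // refl_fix.
have rK : valid (affroot_pull w H) by apply: affroot_pull_valid => //; exact: ext_rev.
exists a, (b * rho (affroot_pull w H))%g; split=> //.
  apply: fixerM => //; split; first exact: (aff_rho R).
  by rewrite rhoE // refl_fix // -aval_pull.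
by rewrite (rho_mulr R m2 rH ew') !mulgA -ew.
Qed.

Lemma min_length_le w0 w (z z' : affperm (2 * m)) : ext_weyl w0 ->
  is_min_length R (double_coset (facet f1) w0 (facet f2)) w ->
  same_coset w z -> based_le p0 (aff_act w p0) (aff_act z p0) ->
  double_coset (facet f1) z (facet f2) z' -> ext_bruhat R w z'.
Proof.
move=> ew0 /(min_length_reduced ew0)[ew redl redr] [g Wg ez] h.
move=> /double_cosetP[a [b [fa fb ->]]].
have ez' : ext_weyl z by rewrite ez; apply: ext_mul => //; exact: aff_ext.
have c : same_coset w z by exists g.
have [g' Wg' e] : same_coset w (a * z * b)%g.
  by apply: same_coset_trans c _; apply: same_coset_fix => //; [case: fa|case: fb].
by rewrite e; apply: based_le_bruhat => //; rewrite -e; exact: reduced_le.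
Qed.

Lemma exists_min_length w0 : exists w,
  is_min_length R (double_coset (facet f1) w0 (facet f2)) w.
Proof.
pose P k := exists2 w, double_coset (facet f1) w0 (facet f2) w & k = ext_length R w.
have [|k [[w hw ->] kmin]] := @nat_min P.
  exists (ext_length R w0), w0 => //; apply/double_cosetP.
  by exists 1%g, 1%g; rewrite mul1g mulg1; split=> //; exact: fixer1.
by exists w; split=> // w' hw'; apply: kmin; exists w'.
Qed.

(** Any comparable representatives do: the minimal [w] lies below [z], hence below [z'], hence by
    [reduced_le] below every element of the second double coset. *)
Lemma dcoset_bruhatP w0 w0' (z z' : affperm (2 * m)) : ext_weyl w0 -> ext_weyl w0' ->
  double_coset (facet f1) w0 (facet f2) z ->
  double_coset (facet f1) w0' (facet f2) z' -> ext_bruhat R z z' ->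
  dcoset_bruhat R (double_coset (facet f1) w0 (facet f2))
    (double_coset (facet f1) w0' (facet f2)).
Proof.
move=> ew0 ew0' /double_cosetP[a [b [fa fb ez]]] /double_cosetP[a' [b' [fa' fb' ez']]].
move=> /(bruhat_based_le m2)[exz zz' le].
have [w hw] := exists_min_length w0; have [w' hw'] := exists_min_length w0'.
exists w, w'; split=> //.
have [ew redl redr] := min_length_reduced ew0 hw.
have /double_cosetP[c [d [fc fd ec]]] := hw.1.
have /double_cosetP[c' [d' [fc' fd' ec']]] := hw'.1.
have [Wa _] := fa; have [Wb _] := fb; have [Wc _] := fc; have [Wd _] := fd.
have zE : z = (a * c^-1 * w * (d^-1 * b))%g.
  by rewrite ez ec !mulgA mulgK mulgKV.
have cwz : same_coset w z.
  by rewrite zE; apply: same_coset_fix => //; apply: aff_mul => //; exact: aff_inv.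
have wz : based_le p0 (aff_act w p0) (aff_act z p0).
  rewrite zE; apply: reduced_le => //; try exact: based_le_refl.
  - by exists 1%g; rewrite ?mul1g //; exact: aff_one.
  - by apply: fixerM => //; exact: fixerV.
  - by apply: fixerM => //; exact: fixerV.
apply: (min_length_le ew0 hw (z := z')).
- exact: same_coset_trans cwz zz'.
- exact: based_le_trans wz le.
apply/double_cosetP; exists (c' * a'^-1)%g, (b'^-1 * d')%g; split.
- by apply: fixerM => //; exact: fixerV.
- by apply: fixerM => //; exact: fixerV.
by rewrite ec' ez' !mulgA mulgK mulgKV.
Qed.

End Reduced.

End DoubleCosets.

(** * Translations by the Weyl orbit *)

Section WeylOrbit.
Variables (m q : nat).
Hypotheses (m2 : (2 <= m)%N) (qm : (q <= m - 1)%N).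
Implicit Types (l : 'rV[int]_(2 * m)) (s : 'S_(2 * m)) (i j k : 'I_(2 * m)).
Local Notation mu := (mu_ m q).
Local Notation orbit := (weyl_orbit mu).

Definition lreflect i j l := l - (l 0 i - l 0 j) *: corootz i j.

Lemma mu_rev i : mu 0 i + mu 0 (rev_ord i) = 2.
Proof.
rewrite !mxE /=; have := ltn_ord i => hi.
case: ifP => h1; case: ifP => h2; try lia; case: ifP => h3; try lia; case: ifP; lia.
Qed.

Lemma orbit_rev l i : orbit l -> l 0 i + l 0 (rev_ord i) = 2.
Proof. by move=> [s [_ sr] ->]; have := mu_rev (s i); rewrite !mxE sr. Qed.

Lemma orbit_cochar l : orbit l -> cochar l.
Proof. by move=> ol i j; rewrite !orbit_rev. Qed.

Lemma orbit_range l i : orbit l -> 0 <= l 0 i <= 2.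
Proof. by move=> [s _ ->]; rewrite !mxE; case: ifP => _ //; case: ifP. Qed.

Lemma orbit_one l : orbit l -> exists k, l 0 k = 1.
Proof.
(* Position [q], counted from 0, lies in the block of ones because q < m. *)
move=> [s _ ->]; have h : (q < 2 * m)%N by lia.
exists (s^-1%g (Ordinal h)); rewrite !mxE permKV /= ltnn ifT //; lia.
Qed.

Lemma orbit_card l : orbit l -> #|[set k | l 0 k == 2]%SET| = #|[set k | mu 0 k ==
  2]%SET|.
Proof.
move=> [s _ ->]; rewrite -(card_preimset [set k | mu 0 k == 2]%SET (@perm_inj _ s)).
by congr #|pred_of_set _|; apply/setP => k; rewrite !inE mxE.
Qed.

Lemma lreflectE i j l : root_index i j -> cochar l ->
  lreflect i j l = col_perm (reflp i j) l.
Proof.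
move=> rij closed_facet; apply/rowP => k; have e := closed_facet i j; have [h1 h2 h3 h4
  h5] := root_index_neq rij.
rewrite [RHS]mxE reflpP //.
have -> : lreflect i j l 0 k = l 0 k - (l 0 i - l 0 j) *
    ((k == i)%:R - (k == j)%:R - (k == rev_ord i)%:R + (k == rev_ord j)%:R).
  have -> : (k == i)%:R - (k == j)%:R -
    (k == rev_ord i)%:R + (k == rev_ord j)%:R = corootz i j 0 k by rewrite mxE.
  by rewrite /lreflect; move: (corootz _ _) => c; rewrite !mxE.
have [->|_] := eqVneq k i; first by rewrite h1 h3 (h5 i).1 /=; lia.
have [->|_] := eqVneq k j; first by rewrite h4 (h5 j).1 /=; lia.
have [->|_] := eqVneq k (rev_ord i); first by rewrite (inj_eq rev_ord_inj) h1 /=; lia.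
by have [->|_] := eqVneq k (rev_ord j); rewrite /=; lia.
Qed.

Lemma orbit_reflect l i j : root_index i j -> orbit l -> orbit (lreflect i j l).
Proof.
move=> rij ol; rewrite lreflectE //; last exact: orbit_cochar.
have [hr sr] := fin_weyl_reflp rij.
case: ol => s [hs ss] ->; exists (reflp i j * s)%g; last first.
  by rewrite col_permM.
split=> [|k]; first by rewrite (odd_permM (reflp i j)) (negbTE hr).
by rewrite !(permM (reflp i j)) sr ss.
Qed.

(* As [q < m], some coordinate of [l] is 1; by dominance this forces
   [rho_(i^* ) < rho_i] wherever [l_i = 2]. *)
Lemma dominant_uniq (R : realType) (rho : 'rV[R]_(2 * m)) l l' : apartment rho ->
  (forall i j, root_index i j -> rho 0 i != rho 0 j) ->
  orbit l -> orbit l' ->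
  (forall i j, root_index i j -> rho 0 j < rho 0 i -> l 0 j <= l 0 i) ->
  (forall i j, root_index i j -> rho 0 j < rho 0 i -> l' 0 j <= l' 0 i) -> l = l'.
Proof.
move=> arho reg ol ol' dom dom'.
(* An orbit element is determined by the places where it is 2, duality giving those where it is
   0. *)
pose A := [set k | l 0 k == 2]%SET; pose A' := [set k | l' 0 k == 2]%SET.
have cAA : #|A| = #|A'| by rewrite !orbit_card.
have [eA|neA] := eqVneq A A'.
  have e k : (l 0 k == 2) = (l' 0 k == 2).
    by have := congr1 (fun B : {set _} => k \in B) eA; rewrite !inE.
  apply/rowP => k; have := e k; have := e (rev_ord k).
  have := orbit_rev k ol; have := orbit_rev k ol'.
  have := orbit_range k ol; have := orbit_range k ol'; lia.
have [i iA iA'] : exists2 i, i \in A & i \notin A'.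
  apply/subsetPn; apply: contra neA => sub; rewrite eqEcard sub cAA //=.
have [j jA' jA] : exists2 j, j \in A' & j \notin A.
  by apply/subsetPn; apply: contra neA => sub; rewrite eq_sym eqEcard sub cAA /=.
rewrite !inE in iA iA' jA jA'.
have big_pos (l1 : 'rV[int]_(2 * m)) i1 : orbit l1 ->
   (forall i j, root_index i j -> rho 0 j < rho 0 i -> l1 0 j <= l1 0 i) ->
   l1 0 i1 = 2 -> rho 0 (rev_ord i1) < rho 0 i1.
  move=> ol1 dom1 l1i; have [k l1k] := orbit_one ol1.
  have gt k1 : l1 0 k1 = 1 -> rho 0 k1 < rho 0 i1.
    move=> l1k1; have r : root_index k1 i1.
      split=> e; first by move: l1i; rewrite e l1k1.
      by have := orbit_rev k1 ol1; rewrite -e l1i l1k1.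
    rewrite ltNge le_eqVlt eq_sym (negbTE (reg _ _ r)) /=.
    by apply/negP => /(dom1 _ _ r); rewrite l1i l1k1.
  have l1k' : l1 0 (rev_ord k) = 1 by have := orbit_rev k ol1; lia.
  by have := gt _ l1k; have := gt _ l1k'; have := arho k i1; lra.
(* If [j] is dual to [i], the two elements demand opposite signs of [rho] at [i]; otherwise one of
   the dominance conditions fails for the pair. *)
have [eij|nij] := eqVneq j (rev_ord i).
  have := big_pos l i ol dom (eqP iA); have := big_pos l' j ol' dom' (eqP jA').
  by rewrite eij rev_ordK => h1 h2; have := lt_trans h1 h2; rewrite ltxx.
have r : root_index i j.
  by split; [move=> e; move: jA; rewrite e iA|exact/eqP].
have r' : root_index j i.
  split; first by move=> e; move: jA; rewrite -e iA.
  by move=> e; case/eqP: nij; rewrite e rev_ordK.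
have := orbit_range j ol; have := orbit_range i ol'.
have [lt|lt|e] := ltgtP (rho 0 i) (rho 0 j).
- by have := dom j i r' lt; lia.
- by have := dom' i j r lt; lia.
by have := reg _ _ r; rewrite e eqxx.
Qed.

End WeylOrbit.

(** * Translates of the base point seen from a moving base *)

Section Translations.
Variables (R : realType) (m : nat).
Hypothesis m2 : (2 <= m)%N.
Local Notation V := 'rV[R]_(2 * m).
Local Notation apt := (@apartment R m).
Local Notation p0 := (@alcove_point R m).
Implicit Types (x y z b : V) (l n : 'rV[int]_(2 * m)) (i j k : 'I_(2 * m)) (H : affroot
  m).

Let rp0 : regular p0 := alcove_regular m2 (alcove_pointP R m2).
Let ap0 : apt p0 := rp0.1.

Definition orbit_point l : V := aff_act (translation l) p0.

Lemma translation_ext l : cochar l -> ext_weyl (translation l).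
Proof. by move=> closed_facet; split=> //; split=> [|i]; rewrite /= ?odd_perm1 ?perm1.
  Qed.

Lemma orbit_pointE l k : orbit_point l 0 k = (l 0 k)%:~R + p0 0 k.
Proof. by rewrite /orbit_point aff_actE perm1. Qed.

Lemma aval_orbit_point H l : aval H (orbit_point l) = aval H p0 + (l 0 H.1.1 - l 0
  H.1.2)%:~R.
Proof. by rewrite /aval !orbit_pointE rmorphB /=; ring. Qed.

Lemma orbit_point_reflect i j l :
  orbit_point (lreflect i j l) = orbit_point l - (l 0 i - l 0 j)%:~R *: coroot R i j.
Proof.
apply/rowP => k; rewrite orbit_pointE.
have -> : lreflect i j l 0 k = l 0 k - (l 0 i - l 0 j) * corootz i j 0 k.
  by rewrite /lreflect; move: (corootz _ _) => c; rewrite !mxE.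
rewrite rmorphB rmorphM /= corootzE; move: (coroot _ _ _) => c.
rewrite -[X in _ = X]/((orbit_point l - _) 0 k).
by rewrite [RHS]mxE [X in _ = _ + X]mxE [X in _ = _ - X]mxE orbit_pointE; ring.
Qed.

Section Orbit.
Variable O : set 'rV[int]_(2 * m).
Hypothesis Or : forall l i j, root_index i j -> O l -> O (lreflect i j l).

(* When the base crosses a wall away from [p0] and the translate of [p0] by [l]
   lies beyond that wall, [l] is replaced by its reflection. *)
Lemma adm_base_change b y l : regular b -> apt y -> O l -> based_le p0 y (orbit_point
  l) ->
  exists2 l', O l' & based_le b y (orbit_point l').
Proof.
move=> rb ay Ol h; have [n] := ubnP (nsep b p0); elim: n b rb => // n IH b rb lebn.
have [[H0 w0 s]|s] := exists_wall rb rp0; last first.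
  exists l => //; apply: based_le_same h => H rH; rewrite mulrC; exact: s.
have r0 := w0.1; have a0 := wall_adjacent rb.1 w0.
have rc := regular_refl r0 rb.
have [|l1 Ol1 le1] := IH _ rc.
  by move: lebn; rewrite ltnS; apply: leq_trans; exact: nsep_wall.
have ac := rc.1; have nc := rc.2 _ r0.
have [h1 h2] := based_le_cross_top ac ay (adjacent_wall_sym a0) nc le1.
rewrite reflK // in h1 h2.
have [hx|hx] := leP 0 (aval H0 (refl H0 b) * aval H0 (orbit_point l1)).
  by exists l1 => //; exact: h1.
have {h1}h2 := h2 (ltW hx).
exists (lreflect H0.1.1 H0.1.2 l1); first exact: Or.
pose c := l1 0 H0.1.1 - l1 0 H0.1.2.
(* The reflections in the parallel hyperplanes [H0] and [H1] compose to the translation from the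
   point of [l1] to that of its reflection. *)
pose H1 : affroot m := (H0.1, H0.2 - c).
have r1 : valid H1 by [].
have e1 x : aval H1 x = aval H0 x + c%:~R.
  by rewrite /aval /= rmorphB /=; ring.
have e2 : aval H0 (orbit_point l1) = aval H0 p0 + c%:~R by exact: aval_orbit_point.
have e3 : aval H1 (refl H0 (orbit_point l1)) = - aval H0 p0.
  by rewrite e1 aval_refl // e2; ring.
have -> : orbit_point (lreflect H0.1.1 H0.1.2 l1) = refl H1 (refl H0 (orbit_point l1)).
  rewrite orbit_point_reflect -/c [refl H1 _]reflE e3 reflE e2.
  by move: (coroot _ _ _) => C; apply/rowP => k; rewrite !mxE; ring.
apply: based_le_step h2 r1 _; rewrite e3 e1.
move: hx; rewrite aval_refl // e2; move: s.
have : 0 < aval H0 p0 ^+ 2 by rewrite exprn_even_gt0 //=; exact: rp0.2.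
move: (aval H0 p0) (aval H0 b) (c%:~R) => P B C hP hBP; rewrite mulNr oppr_lt0 => hBC.
by have := mul_gt0_lt0 hBC hBP; lra.
Qed.

(** The translation along the coroot is a product of two parallel reflections. As the difference is
    at least -2, the gap of 2 leaves [b] on the negative side of both, and each step moves away from
    it. *)
Lemma orbit_point_raise b l i j : root_index i j -> -2 <= l 0 i - l 0 j < 0 ->
  b 0 i - b 0 j < p0 0 i - p0 0 j - 2 ->
  based_le b (orbit_point l) (orbit_point (lreflect i j l)).
Proof.
move=> rij /andP[c2 c0] hb.
set c := l 0 i - l 0 j in c2 c0.
(* The least integer above the difference at [p0], so that [H2] is the first such hyperplane above
   the translate by [l]. *)
have [k ek] : {k | k = floor_diff p0 (i, j) + 1} by exists (floor_diff p0 (i, j) + 1).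
pose H2 : affroot m := (i, j, k + c); pose H1 : affroot m := (i, j, k).
have r2 : valid H2 by []. have r1 : valid H1 by [].
have p1 : p0 0 i - p0 0 j < k%:~R.
  by rewrite ek; have /andP[] := floor_itv (p0 0 i - p0 0 j).
have p2 : k%:~R < p0 0 i - p0 0 j + 1.
  have rF : valid (i, j, floor_diff p0 (i, j)) by [].
  have : 0 < aval (i, j, floor_diff p0 (i, j)) p0 by rewrite lt_neqAle eq_sym (rp0.2 _
    rF) aval_ge0 /=.
  by rewrite ek rmorphD /aval /=; lra.
have C2 : -2 <= c%:~R :> R by rewrite -[X in X <= _]/((-2)%:~R) ler_int.
have C0 : c%:~R <= -1 :> R by rewrite -[X in _ <= X]/((-1)%:~R) ler_int; lia.
have h2 : aval H2 (orbit_point l) = p0 0 i - p0 0 j - k%:~R.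
  by rewrite aval_orbit_point /= -/c /aval /= rmorphD /=; ring.
have e1 x : aval H1 x = aval H2 x + c%:~R.
  by rewrite /aval /= (rmorphD _ k c) /=; ring.
have hb2 : aval H2 b < 0 by rewrite /aval /= rmorphD /=; lra.
have h1 : aval H1 (refl H2 (orbit_point l)) = k%:~R - (p0 0 i - p0 0 j) + c%:~R.
  by rewrite e1 aval_refl // h2; ring.
have -> : orbit_point (lreflect i j l) = refl H1 (refl H2 (orbit_point l)).
  rewrite orbit_point_reflect -/c [refl H1 _]reflE h1 reflE h2 /=.
  by move: (coroot _ _ _) => C; apply/rowP => k1; rewrite !mxE; ring.
apply: based_le_step (based_le1 r2 _) r1 _.
  by rewrite h2 nmulr_rgt0 //; lra.
by rewrite h1 e1 nmulr_rgt0; lra.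
Qed.

End Orbit.

(* A large multiple of [- rho], rounded to an integral vector. *)
Lemma antidominant_shift (rho : V) : apt rho ->
  (forall i j, root_index i j -> rho 0 i != rho 0 j) ->
  exists n : 'rV[int]_(2 * m), cochar n /\
    forall i j, root_index i j -> rho 0 j < rho 0 i -> (n 0 i - n 0 j)%:~R < -2 :> R.
Proof.
move=> arho reg.
(* [M] makes every scaled gap at least 2. Antisymmetrizing [n] gives a cocharacter and doubles the
   gap to 4, while the four roundings cost less than 2. *)
pose M := \sum_(ij | validb ij) 2 / `|rho 0 ij.1 - rho 0 ij.2| : R.
pose n : 'rV[int]_(2 * m) :=
  \row_i (Num.floor (- M * rho 0 i) - Num.floor (- M * rho 0 (rev_ord i))).
exists n; split.
  by move=> i j; rewrite !mxE !rev_ordK; ring.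
move=> i j rij lt; rewrite !mxE.
have rb : validb (i, j) by exact/(validP (i, j, 0)).
have d0 : 0 < rho 0 i - rho 0 j by rewrite subr_gt0.
have Mge : 2 / (rho 0 i - rho 0 j) <= M.
  rewrite /M (bigD1 (i, j)) //= gtr0_norm // lerDl.
  by apply: sumr_ge0 => ij _; rewrite divr_ge0.
have {Mge} : 2 <= M * (rho 0 i - rho 0 j) by rewrite -ler_pdivrMr.
have := arho i j.
have /andP[] := floor_itv (- M * rho 0 i).
have /andP[] := floor_itv (- M * rho 0 j).
have /andP[] := floor_itv (- M * rho 0 (rev_ord i)).
have /andP[] := floor_itv (- M * rho 0 (rev_ord j)).
move: (Num.floor _) (Num.floor _) (Num.floor _) (Num.floor _) => a1 a2 a3 a4.
rewrite !(rmorphD, rmorphN, rmorphB) /= => h1 h2 h3 h4 h5 h6 h7 h8 h9 h10.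
have : M * (rho 0 i - rho 0 j) = M * (rho 0 (rev_ord j) - rho 0 (rev_ord i)).
  by congr (_ * _); lra.
rewrite !mulrBr in h10 *; lra.
Qed.

(** In [general_position] the functions [f] keep the point in the alcove, and the functions [g] keep
    its difference with [y] off the linear root hyperplanes. *)
Lemma generic_alcove_point y : apt y ->
  exists p, base_alcove p /\ forall i j, root_index i j -> y 0 i - p 0 i != y 0 j - p 0
    j.
Proof.
move=> ay.
pose f (ij : 'I_(2 * m) * 'I_(2 * m)) x := if validb ij then aval (ij, floor_diff p0
  ij) x else 1.
pose g (ij : 'I_(2 * m) * 'I_(2 * m)) x :=
  if validb ij then aval (ij, 0) x - aval (ij, 0) y else 1.
have [||||p [app fp gp]] := @general_position R m _ _ f g p0 ap0.
- by move=> ij x z t; rewrite /f; case: ifP => _; [exact: aval_segment|ring].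
- by move=> ij x z t; rewrite /g; case: ifP => _; rewrite ?aval_segment; ring.
- move=> ij; rewrite /f; case: ifP => // r.
  by rewrite lt_neqAle eq_sym aval_ge0 lexx andbT; apply: rp0.2; exact/(validP (ij, _)).
- move=> ij; have [r|nr] := boolP (validb ij); last first.
    by exists p0; rewrite // /g (negbTE nr) oner_neq0.
  exists (((aval (ij, 0) y + 1) / 2) *: coroot R ij.1 ij.2); first
    exact/aptZ/apt_coroot.
  rewrite /g r (aval_coroot (H := (ij, 0))); last exact/(validP (ij, 0)).
  move: (aval _ y) => c /=.
  have -> : 2 * ((c + 1) / 2) - 0%:~R - c = 1 :> R by field.
  exact: oner_neq0.
exists p; split; last first.
  move=> i j rij; have := gp (i, j); rewrite /g (introT (validP (i, j, 0)) rij).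
  by apply: contra => /eqP e; apply/eqP; rewrite /aval /=; lra.
apply: (alcove_same m2 (alcove_pointP R m2)) => //.
apply: (wlog_opp rp0) => [H|H rH Hp]; first by rewrite !aval_opp mulrNN.
apply: mulr_gt0 => //; have r : validb H.1 by exact/validP.
have := fp H.1; rewrite /f r => /lt_le_trans; apply.
have := ltW Hp; rewrite aval_ge0; case: H {rH Hp r} => ij d /= le.
by rewrite (aval_shift ij d (floor_diff p0 ij)) lerDl ler0z subr_ge0.
Qed.

End Translations.

(** * Vertexwise admissibility *)

Section Main.
Variables (R : realType) (m q : nat).
Hypotheses (m2 : (2 <= m)%N) (qm : (q <= m - 1)%N).
Local Notation V := 'rV[R]_(2 * m).
Local Notation apt := (@apartment R m).
Local Notation p0 := (@alcove_point R m).
Local Notation W := (@aff_weyl m).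
Local Notation mu := (mu_ m q).
Local Notation orbit := (weyl_orbit mu).
Implicit Types (x y z b f v : V) (l n : 'rV[int]_(2 * m)) (i j k : 'I_(2 * m)).
Implicit Types (H : affroot m) (g u w : affperm (2 * m)).

Let rp0 : regular p0 := alcove_regular m2 (alcove_pointP R m2).
Let ap0 : apt p0 := rp0.1.
Let p0a : base_alcove p0 := alcove_pointP R m2.

Lemma orbit_ext l : orbit l -> ext_weyl (translation l).
Proof. by move=> ol; apply: translation_ext; exact: (orbit_cochar m2 qm). Qed.

(** While [l] is not dominant for [rho], [orbit_point_raise] goes up and the pairing [phi] with
    [rho] grows. A maximizer of [phi] is thus dominant, and the dominant element is unique. *)
Lemma orbit_top b rho : apt rho ->
  (forall i j, root_index i j -> rho 0 i != rho 0 j) ->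
  (forall i j, root_index i j -> rho 0 j < rho 0 i ->
     b 0 i - b 0 j < p0 0 i - p0 0 j - 2) ->
  exists2 l0, orbit l0 & forall l, orbit l -> based_le b (orbit_point R l) (orbit_point
    R l0).
Proof.
move=> arho reg hb.
pose dom l := forall i j, root_index i j -> rho 0 j < rho 0 i -> l 0 j <= l 0 i.
pose phi l : R := \sum_k (l 0 k)%:~R * rho 0 k.
have phi_refl l i j : phi (lreflect i j l) =
    phi l - (l 0 i - l 0 j)%:~R * (2 * (rho 0 i - rho 0 j)).
  rewrite -coroot_dot // mulr_sumr -sumrB; apply: eq_bigr => k _.
  have -> : lreflect i j l 0 k = l 0 k - (l 0 i - l 0 j) * corootz i j 0 k.
    by rewrite /lreflect; move: (corootz _ _) => c; rewrite !mxE.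
  by rewrite rmorphB rmorphM /= corootzE mulrBl mulrA.
have ex_dom l : orbit l -> exists l1, [/\ orbit l1, dom l1 & based_le b (orbit_point R
  l) (orbit_point R l1)].
  (* Maximizing over permutations instead of orbit elements makes the search finite. *)
  move=> [s fs es]; pose P s := `[< fin_weyl s /\ based_le b (orbit_point R l)
    (orbit_point R (col_perm s mu)) >].
  have Ps : P s by apply/asboolP; split=> //; rewrite es; exact: based_le_refl.
  have [s1 /asboolP[fs1 le1] smax] := arg_maxP (fun s => phi (col_perm s mu)) Ps.
  have o1 : orbit (col_perm s1 mu) by exists s1.
  exists (col_perm s1 mu); split=> // i j rij lt; rewrite leNgt; apply/negP => lt1.
  have /andP[c0 c2] : -2 <= col_perm s1 mu 0 i - col_perm s1 mu 0 j < 0.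
    by have := orbit_range i o1; have := orbit_range j o1; lia.
  have [s2 fs2 es2] := orbit_reflect m2 qm rij o1.
  have /smax : P s2.
    apply/asboolP; split=> //; apply: based_le_trans le1 _; rewrite -es2.
    by apply: orbit_point_raise => //; [rewrite c0 c2|exact: hb].
  rewrite /= -es2 phi_refl leNgt => /negP; apply.
  rewrite ltrBrDr gtrDl nmulr_rlt0 ?ltrz0 // mulr_gt0 // subr_gt0 //.
have omu : orbit mu.
  exists 1%g; last by rewrite col_perm1.
  by split=> [|i]; rewrite ?odd_perm1 ?perm1.
have [l0 [o0 d0 _]] := ex_dom _ omu; exists l0 => // l /ex_dom[l1 [o1 d1 le1]].
by rewrite (dominant_uniq m2 qm arho reg o0 o1 d0 d1).
Qed.

Section FacetPair.
Variables (f f' : V).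
Hypotheses (af : apt f) (af' : apt f') (cf' : closed_facet p0 f') (cff : closed_facet
  f' f).

Let cf : closed_facet p0 f := closed_facet_trans cf' cff.

Lemma span_double_coset v w : apt v -> closed_facet f v ->
  dcoset_span (facet v) (double_coset (facet f') w (facet f)) (facet v) =
  double_coset (facet v) w (facet v).
Proof.
move=> av cv; have cv0 := closed_facet_trans cf cv.
apply/seteqP; split=> z.
  move=> [a [x [b [/(facet_stabP m2 _ av cv0) fa]]]].
  move=> /(double_cosetP m2 af' af cf' cf)[a1 [b1 [fa1 fb1 ->]]].
  move=> /(facet_stabP m2 _ av cv0) fb ->.
  apply/double_cosetP => //; exists (a * a1)%g, (b1 * b)%g; split.
  - by apply: fixerM fa _; apply: fixer_sub fa1 => //; exact: closed_facet_trans cff cv.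
  - by apply: fixerM _ fb; apply: fixer_sub fb1.
  by rewrite !mulgA.
move=> [a [x [b [fa ex fb ez]]]]; exists a, x, b; split=> //.
rewrite ex; apply/double_cosetP => //; exists 1%g, 1%g; rewrite mul1g mulg1.
by split=> //; exact: fixer1.
Qed.

(** The comparable representatives also lie in the larger double cosets of each vertex. *)
Lemma Adm_sub_vert D : Adm (facet f') (facet f) mu D -> Adm_vert (facet f') (facet f)
  mu D.
Proof.
move=> [[w0 ew0 ->] [l ol [z [z' [[hz _] [hz' _] br]]]]].
split; first by exists w0.
move=> _ [[v av ->] _] le; rewrite -/(facet v) in le *.
have cv := (facet_leP af av).1 le; have cv0 := closed_facet_trans cf cv.
rewrite span_double_coset //; split; first by exists w0.
have sub w u : double_coset (facet f') w (facet f) u -> double_coset (facet v) w (facet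
  v) u.
  move=> h; rewrite -span_double_coset //; exists 1%g, u, 1%g.
  by split=> //; rewrite ?mul1g ?mulg1 //; apply/facet_stabP => //; exact: fixer1.
exists l => //; apply: (dcoset_bruhatP m2 av av cv0 cv0 ew0 (orbit_ext ol) _ _ br);
  exact: sub.
Qed.

Lemma vertex_bound v w l : apt v -> closed_facet f v -> ext_weyl w -> orbit l ->
  dcoset_bruhat R (double_coset (facet v) w (facet v))
    (double_coset (facet v) (translation l) (facet v)) ->
  same_coset w (translation l) /\
  forall b, regular b -> exists2 l', orbit l' &
    based_le b (aff_act w v) (aff_act (translation l') v).
Proof.
move=> av cv ew ol [y [y' [miny miny' br]]].
have cv0 := closed_facet_trans cf cv.
have [ey yy' le] := bruhat_based_le m2 br.
have /(double_cosetP m2 av av cv0 cv0)[a [b1 [fa fb1 eyE]]] := miny.1.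
have /(double_cosetP m2 av av cv0 cv0)[a' [b' [fa' fb' ey'E]]] := miny'.1.
(* The translation itself replaces the minimal representative [y'] as upper bound. *)
have br' : ext_bruhat R y (translation l).
  apply: (min_length_le m2 av av cv0 cv0 ew miny yy' le).
  apply/double_cosetP => //; exists a'^-1%g, b'^-1%g; split; try exact: fixerV.
  by rewrite ey'E !mulgA mulVg mul1g mulgK.
have [_ yt let'] := bruhat_based_le m2 br'.
have [Wa ha] := fa; have [Wb hb] := fb1.
split.
  apply: same_coset_trans yt; rewrite eyE.
  exact: (same_coset_fix R m2 ew Wa Wb).
move=> b rb; have ea := aff_ext Wa; have rab := regular_act ea rb.
have [l1 ol1 le1] := adm_base_change m2 (O := orbit)
  (fun l i j => @orbit_reflect m q m2 qm l i j) rab (ext_apt ey ap0) ol let'.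
have eaV := ext_inv ea.
have := based_le_act (ext_rev eaV) le1; rewrite aff_actK -aff_actM.
have -> : (a^-1 * y = w * b1)%g by rewrite eyE !mulgA mulVg mul1g.
rewrite /orbit_point -aff_actM.
(* Moving the inverse of [a] past the translation replaces [l1] by its image [l2] in the orbit. *)
pose l2 := col_perm (lin a^-1%g) l1.
have o2 : orbit l2.
  have [_ [hs ss]] := eaV; have [s [h1 h2] es] := ol1.
  exists (lin a^-1 * s)%g; last by rewrite /l2 es col_permM.
  split=> [|i]; first by rewrite odd_permM (negbTE hs).
  by rewrite !permM ss h2.
have -> : (a^-1 * translation l1 = translation l2 * a^-1)%g.
  rewrite /mulg /= /affperm_mul /=; congr AffPerm; last by rewrite mulg1 mul1g.
  by rewrite col_perm1 addrC.
have ewb : ext_weyl (w * b1)%g by apply: ext_mul => //; exact: aff_ext.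
move=> /(based_le_chain rp0 ewb)[g [_ e h]].
exists l2 => //; have := h v av cv0.
rewrite -(aff_act_inj m2 e) !aff_actM hb.
by have [_ ->] := fixerV fa.
Qed.

Lemma vert_sub_Adm D : Adm_vert (facet f') (facet f) mu D -> Adm (facet f') (facet f)
  mu D.
Proof.
move=> [[w0 ew0 ->] vert]; split; first by exists w0.
pose S v := [/\ apt v, closed_facet f v & is_minimal_facet (facet v)].
have aw0f : apt (aff_act w0 f) by exact: ext_apt.
have hull (P : V -> Prop) : (forall x y t, P x -> P y -> P (x + t *: (y - x))) ->
    (forall v, S v -> P v) -> P f.
  by move=> hP hS; apply: facet_hull => // v av cv vmin; exact: hS.
have vb v : S v -> exists2 l, orbit l & same_coset w0 (translation l) /\
    forall b, regular b -> exists2 l', orbit l' &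
      based_le b (aff_act w0 v) (aff_act (translation l') v).
  move=> [av cv vmin]; have := vert _ vmin ((facet_leP af av).2 cv).
  rewrite span_double_coset // => -[_ [l ol h]].
  by exists l => //; exact: vertex_bound h.
have [p [pa hp]] := generic_alcove_point m2 aw0f.
pose rho := aff_act w0 f - p.
have arho : apt rho by apply: aptB => //; case: pa.
have diffE i j : rho 0 i - rho 0 j =
    aff_act w0 f 0 i - aff_act w0 f 0 j - (p 0 i - p 0 j).
  rewrite /rho; move: (aff_act w0 f) => z; rewrite !mxE; ring.
have reg i j : root_index i j -> rho 0 i != rho 0 j.
  by move=> /hp; rewrite /rho; move: (aff_act w0 f) => z; rewrite !mxE.
have [n [cn hn]] := antidominant_shift arho reg.
pose b := orbit_point R n.
have rb : regular b by apply: regular_act => //; exact: translation_ext.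
have bE i j : b 0 i - b 0 j = p0 0 i - p0 0 j + (n 0 i - n 0 j)%:~R.
  by rewrite /b !orbit_pointE rmorphB /=; ring.
have [l0 o0 top] : exists2 l0, orbit l0 &
    forall l, orbit l -> based_le b (orbit_point R l) (orbit_point R l0).
  by apply: orbit_top arho reg _ => i j rij /(hn _ _ rij); rewrite bE; lra.
have t0 := orbit_ext o0.
have topv l v : orbit l -> apt v -> closed_facet p0 v ->
    based_le b (aff_act (translation l) v) (aff_act (translation l0) v) /\
    same_coset (translation l) (translation l0).
  move=> ol av cv; have := top l ol; rewrite /orbit_point.
  move=> /(based_le_chain rp0 (orbit_ext ol))[g [Wg e h]].
  by rewrite (aff_act_inj m2 e); split; [exact: h|exists g].
have vle v : S v -> based_le b (aff_act w0 v) (aff_act (translation l0) v).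
  move=> Sv; have [l ol [_ h]] := vb v Sv; have [l' ol' le] := h b rb.
  have [av cv _] := Sv.
  exact: based_le_trans le (topv _ _ ol' av (closed_facet_trans cf cv)).1.
have le0 : based_le b (aff_act w0 f) (aff_act (translation l0) f).
  apply: (deodhar rb rp0 af cf _ hull ew0 t0 vle).
  by move=> v [av cv _]; split=> //; exact: closed_facet_trans cf cv.
(* The coset is not visible at [f] and is read off at a vertex. Some vertex exists, since [hull]
   would otherwise prove the false predicate. *)
have [h Wh eh] : same_coset w0 (translation l0).
  apply: contrapT => nsc.
  suff : (fun _ : V => False) f by [].
  apply: hull => // v Sv; have [l ol [sc _]] := vb v Sv.
  have [av cv _] := Sv.
  apply: nsc; apply: same_coset_trans sc _.
  exact: (topv _ _ ol av (closed_facet_trans cf cv)).2.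
have [g [Wg eg leg]] := based_le_lift_bot rp0 af cf ew0 le0.
have {}leg : based_le p0 (aff_act w0 p0) (aff_act (g * w0)%g p0).
  apply: (based_le_move rb rp0 (ext_apt ew0 ap0) _ leg).
  apply: (wlog_opp rp0) => [H|H rH Hp]; first by rewrite !aval_opp !mulrNN.
  rewrite pmulr_llt0 // => Hb.
  (* Here [H] separates [b] from [p0]: along it [n] decreases, hence [rho] increases, and [w0 f]
     lies beyond [p] on the positive side. *)
  have nlt : (n 0 H.1.1 - n 0 H.1.2)%:~R < 0 :> R.
    by move: Hp Hb; rewrite /aval bE; lra.
  have rpos : rho 0 H.1.2 < rho 0 H.1.1.
    rewrite ltNge le_eqVlt; apply/negP => /orP[|lt].
      by apply/negP; exact: reg.
    have rH' : root_index H.1.2 H.1.1 by exact: (affroot_opp_valid rH).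
    by have := hn _ _ rH' lt; move: nlt; rewrite !rmorphB /=; lra.
  have Hpp : 0 < aval H p.
    by have := alcove_sign m2 p0a pa rH; rewrite pmulr_rgt0.
  apply/ltW; apply: (closed_facet_strict rH (closed_facet_act ew0 cf)).
    exact: (regular_act ew0 rp0).2.
  have : 0 < rho 0 H.1.1 - rho 0 H.1.2 by rewrite subr_gt0.
  by rewrite pmulr_rgt0 // diffE; move: Hpp; rewrite /aval; lra.
exists l0 => //.
apply: (dcoset_bruhatP m2 af' af cf' cf ew0 t0 (z := w0) (z' := (g * w0)%g)).
- apply/double_cosetP => //; exists 1%g, 1%g; rewrite mul1g mulg1.
  by split=> //; exact: fixer1.
(* The elements [g w0] and the translation agree on [f] and share a coset, so they differ by a right
   factor fixing [f]. *)
- apply/double_cosetP => //; exists 1%g, ((translation l0)^-1 * (g * w0))%g.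
  split; [exact: fixer1| |by rewrite mul1g mulKVg].
  split; last by rewrite aff_actM -eg aff_actK.
  have -> : (g * w0 = g * h^-1 * translation l0)%g by rewrite eh mulgA mulgKV.
  rewrite mulgA; apply: (aff_conjV R m2 t0); apply: aff_mul => //; exact: aff_inv.
exact: based_le_bruhat.
Qed.

End FacetPair.

End Main.

Theorem theorem8p15p3 (R : realType) (m q : nat) (F F' : set 'rV[R]_(2 * m)) :
  (2 <= m)%N -> (q <= m - 1)%N ->
  is_facet F -> is_facet F' ->
  facet_le F F' -> facet_le F' (@base_alcove R m) ->
  Adm F' F (mu_ m q) = Adm_vert F' F (mu_ m q).
Proof.
move=> m2 qm [f af ->] [f' af' ->]; rewrite -/(facet f) -/(facet f') => le le'.
have pa := alcove_pointP R m2; have [ap0 _ _] := pa.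
have cff := (facet_leP af' af).1 le.
have cf' : closed_facet (alcove_point R m) f'.
  by apply/facet_leP => //; rewrite -(alcove_facet m2 pa).
by apply/seteqP; split=> D; [exact: Adm_sub_vert|exact: vert_sub_Adm].
Qed.
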